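(* Let $K$ be a difference field of zero characteristic with a basic set of translations $\sigma=\{\alpha_{1},\dots,\alpha_{m}\}$ ($m\geq 1$) that are assigned positive integer weights $w_{1},\dots,w_{m}$, respectively. Let $L=K\langle\eta_{1},\dots,\eta_{n}\rangle$ be a $\sigma$-field extension of $K$ generated by a finite set $\eta=\{\eta_{1},\dots,\eta_{n}\}$. For any $r\in\mathbb{N}$, let $L_{r}=K\bigl(\bigcup_{i=1}^{n}T_{w}(r)\eta_{i}\bigr)$. Then there exists a quasi-polynomial $\Phi^{(w)}_{\eta|K}(t)$ such that: (i) $\Phi^{(w)}_{\eta|K}(r)=\operatorname{tr.deg}_{K}L_{r}$ for all sufficiently large $r\in\mathbb{N}$. (ii) $\deg\Phi^{(w)}_{\eta|K}\leq m=\operatorname{Card}\sigma$. (iii) $\Phi^{(w)}_{\eta|K}$ is an alternating sum of Ehrhart quasi-polynomials associated with rational conic polytopes. (iv) The degree and leading coefficient of the quasi-polynomial $\Phi^{(w)}_{\eta|K}$ are constants that do not depend on the set of difference generators $\eta$ of the extension $L/K$ (that is, they are the same for every finite set of $\sigma$-generators of $L$ over $K$). Furthermore, the coefficient of $t^{m}$ in $\Phi^{(w)}_{\eta|K}$ can be represented as $\dfrac{a}{m!\,w_{1}\cdots w_{m}}$, where $a$ is equal to the difference transcendence degree of $L/K$.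
   Context: $\mathbb{N}$ is the set of non-negative integers. Difference fields. A difference ring with basic set $\sigma=\{\alpha_{1},\dots,\alpha_{m}\}$ (a $\sigma$-ring) is a commutative ring together with a finite set $\sigma$ of mutually commuting endomorphisms, called translations; translations are assumed throughout to be injective (they need not be surjective). If the ring is a field it is called a difference (or $\sigma$-) field. $T$ denotes the free commutative semigroup (with identity) of all power products $\tau=\alpha_{1}^{k_{1}}\cdots\alpha_{m}^{k_{m}}$ ($k_{1},\dots,k_{m}\in\mathbb{N}$); it acts on any $\sigma$-ring, and $\tau a$ denotes $\tau(a)$. A $\sigma$-field extension $L/K$ consists of a $\sigma$-field $L$ and a subfield $K$ closed under all translations, with the translations of $K$ being the restrictions of those of $L$. For $S\subseteq L$, $K\langle S\rangle$ denotes the smallest $\sigma$-subfield of $L$ containing $K$ and $S$; thus $K\langle\eta_{1},\dots,\eta_{n}\rangle=K(\{\tau\eta_{i}\mid\tau\in T,\ 1\leq i\leq n\})$, and $\eta_{1},\dots,\eta_{n}$ are then called $\sigma$-generators (difference generators) of this extension of $K$. Weights. For $\tau=\alpha_{1}^{k_{1}}\cdots\alpha_{m}^{k_{m}}\in T$, the order of $\tau$ is $\operatorname{ord}_{w}\tau=\sum_{i=1}^{m}w_{i}k_{i}$. For $r\in\mathbb{N}$, $T_{w}(r)=\{\tau\in T\mid\operatorname{ord}_{w}\tau\leq r\}$ and $T_{w}(r)\eta_{i}=\{\tau\eta_{i}\mid\tau\in T_{w}(r)\}$. Difference transcendence degree. A family $(u^{(\lambda)})_{\lambda\in\Lambda}$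 of elements of $L$ is $\sigma$-algebraically dependent over $K$ if the family $(\tau u^{(\lambda)})_{\tau\in T,\lambda\in\Lambda}$ is algebraically dependent over $K$; otherwise it is $\sigma$-algebraically independent over $K$. An element $a\in L$ is $\sigma$-algebraic over a $\sigma$-subfield $F$ if the family $(\tau a)_{\tau\in T}$ is algebraically dependent over $F$. A set $B\subseteq L$ is a difference ($\sigma$-) transcendence basis of $L$ over $K$ if $B$ is $\sigma$-algebraically independent over $K$ and every element of $L$ is $\sigma$-algebraic over $K\langle B\rangle$. If $L$ is a finitely generated $\sigma$-field extension of $K$, all $\sigma$-transcendence bases of $L$ over $K$ are finite and have the same number of elements, called the difference (or $\sigma$-) transcendence degree of $L/K$. Quasi-polynomials. A (univariate) quasi-polynomial of period $q$ ($q$ a positive integer) is a function $f:\mathbb{Z}\to\mathbb{Q}$ for which there exist $q$ polynomials $g_{i}(x)\in\mathbb{Q}[x]$ ($0\leq i\leq q-1$) such that $f(n)=g_{i}(n)$ whenever $n\in\mathbb{Z}$ and $n\equiv i\pmod q$. Equivalently, $f(n)=c_{d}(n)n^{d}+\dots+c_{1}(n)n+c_{0}(n)$, where each $c_{i}:\mathbb{Z}\to\mathbb{Q}$ is a periodic function (the coefficient of $t^{i}$); if $c_{d}$ is not identically $0$, then $d$ is the degree of $f$ and $c_{d}$ is its leading coefficient. The zero quasi-polynomial is regarded as having degree less than $0$ (with leading coefficient $0$). Ehrhart quasi-polynomials of conic polytopes. $\lambda^{(m)}_{w}(t)$ denotes the Ehrhart quasi-polynomial that describes the number of integer points in the conic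 polytope $\{(x_{1},\dots,x_{m})\in\mathbb{R}^{m}\mid\sum_{i=1}^{m}w_{i}x_{i}\leq t,\ x_{j}\geq 0\ (1\leq j\leq m)\}$; that is, $\lambda^{(m)}_{w}$ is the quasi-polynomial with $\lambda^{(m)}_{w}(r)=\operatorname{Card}\{(k_{1},\dots,k_{m})\in\mathbb{N}^{m}\mid\sum_{i=1}^{m}w_{i}k_{i}\leq r\}$ for every $r\in\mathbb{N}$. In (iii), an alternating sum of Ehrhart quasi-polynomials associated with rational conic polytopes means a finite sum of terms of the form $\pm\lambda^{(m)}_{w}(t-c)$ with $c\in\mathbb{N}$. *)

(* Defs.v *)
From HB Require Import structures.
From mathcomp Require Import all_boot all_order all_algebra.
From mathcomp Require Import boolp classical_sets cardinality.
From mathcomp Require Import mpoly.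

Set Implicit Arguments.
Unset Strict Implicit.
Unset Printing Implicit Defensive.

Import GRing.Theory.

Local Open Scope card_scope.
Local Open Scope classical_set_scope.
Local Open Scope ring_scope.

(* Subfields of L are arbitrary (Prop-valued) subsets of L, since neither
   L / K nor the intermediate extensions are of finite degree in general. *)
Definition subfield (L : fieldType) (F : set L) : Prop :=
  GRing.divring_closed (mem F).

Definition adjoin (L : fieldType) (K S : set L) : set L :=
  smallest (@subfield L) (K `|` S).

Definition algebraic_over (L : fieldType) (F : set L) (x : L) : Prop :=
  exists p : {poly L}, [/\ p \is a polyOver (mem F), p != 0 & root p x].

(* The family (u i), i \in D, is algebraically dependent over K. As a family
   is meant, two equal members with distinct indices are dependent. *)
Definition alg_dependent (L : fieldType) (K : set L) (I : Type) (D : set I)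
    (u : I -> L) : Prop :=
  exists (n : nat) (s : 'I_n -> I) (p : {mpoly L[n]}),
    [/\ injective s, forall j, D (s j), p \is a mpolyOver n (mem K),
        p != 0 & p.@[u \o s] = 0].

Definition transcendence_basis (L : fieldType) (K F B : set L) : Prop :=
  [/\ B `<=` F, ~ alg_dependent K B id
    & forall x, F x -> algebraic_over (adjoin K B) x].

Definition has_trdeg (L : fieldType) (K F : set L) (d : nat) : Prop :=
  exists2 B : set L, transcendence_basis K F B & B #= `I_d.

(* Translations of a difference field are ring endomorphisms; they are
   injective because L is a field. *)
Definition commuting (L : fieldType) (m : nat)
    (alpha : 'I_m -> {rmorphism L -> L}) : Prop :=
  forall i j x, alpha i (alpha j x) = alpha j (alpha i x).

Definition sigma_subfield (L : fieldType) (m : nat)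
    (alpha : 'I_m -> {rmorphism L -> L}) (F : set L) : Prop :=
  subfield F /\ forall i x, F x -> F (alpha i x).

Definition sigma_adjoin (L : fieldType) (m : nat)
    (alpha : 'I_m -> {rmorphism L -> L}) (K S : set L) : set L :=
  smallest (sigma_subfield alpha) (K `|` S).

(* The free commutative semigroup T is the type 'X_{1..m} of exponent vectors;
   k stands for alpha_1^{k_1} ... alpha_m^{k_m}. *)
Definition translate (L : fieldType) (m : nat)
    (alpha : 'I_m -> {rmorphism L -> L}) (k : 'X_{1..m}) : L -> L :=
  \big[(fun f g : L -> L => f \o g)/id]_(i < m) iter (k i) (alpha i).

Definition ord_w (m : nat) (w : 'I_m -> nat) (k : 'X_{1..m}) : nat :=
  (\sum_(i < m) w i * k i)%N.

Definition Tw (m : nat) (w : 'I_m -> nat) (r : nat) : set 'X_{1..m} :=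
  [set k | (ord_w w k <= r)%N].

Definition filtration (L : fieldType) (m : nat)
    (alpha : 'I_m -> {rmorphism L -> L}) (w : 'I_m -> nat) (K : set L)
    (n : nat) (eta : 'I_n -> L) (r : nat) : set L :=
  adjoin K (\bigcup_i ((fun k => translate alpha k (eta i)) @` Tw w r)).

Definition sigma_generators (L : fieldType) (m : nat)
    (alpha : 'I_m -> {rmorphism L -> L}) (K : set L)
    (n : nat) (eta : 'I_n -> L) : Prop :=
  sigma_adjoin alpha K (range eta) = setT.

Definition sigma_dependent (L : fieldType) (m : nat)
    (alpha : 'I_m -> {rmorphism L -> L}) (K B : set L) : Prop :=
  alg_dependent K (setT `*` B)
    (fun ku : 'X_{1..m} * L => translate alpha ku.1 ku.2).

Definition sigma_algebraic (L : fieldType) (m : nat)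
    (alpha : 'I_m -> {rmorphism L -> L}) (F : set L) (x : L) : Prop :=
  alg_dependent F setT (fun k => translate alpha k x).

Definition sigma_transcendence_basis (L : fieldType) (m : nat)
    (alpha : 'I_m -> {rmorphism L -> L}) (K B : set L) : Prop :=
  ~ sigma_dependent alpha K B /\
  forall x, sigma_algebraic alpha (sigma_adjoin alpha K B) x.

Definition has_sigma_trdeg (L : fieldType) (m : nat)
    (alpha : 'I_m -> {rmorphism L -> L}) (K : set L) (a : nat) : Prop :=
  exists2 B : set L, sigma_transcendence_basis alpha K B & B #= `I_a.

(* A quasi-polynomial is given by the nonempty list g_0, ..., g_{q-1} of its
   constituents, q being the size of the list. The value, coefficients and
   size below depend only on the function Z -> Q it denotes. *)
Record quasi_poly := QuasiPoly {
  qp_parts : seq {poly rat};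
  qp_parts_gt0 : (0 < size qp_parts)%N }.

Definition qp_part (f : quasi_poly) (t : int) : {poly rat} :=
  nth 0 (qp_parts f) `|(t %% (size (qp_parts f))%:Z)%Z|%N.

Definition qp_eval (f : quasi_poly) (t : int) : rat := (qp_part f t).[t%:~R].

Coercion qp_eval : quasi_poly >-> Funclass.

Definition qp_coef (f : quasi_poly) (i : nat) (t : int) : rat :=
  (qp_part f t)`_i.

(* As for polynomials, the size is the degree plus one, and is 0 for the zero
   quasi-polynomial. *)
Definition qp_size (f : quasi_poly) : nat :=
  (\max_(g <- qp_parts f) size g)%N.

Definition qp_lead_coef (f : quasi_poly) : int -> rat :=
  qp_coef f (qp_size f).-1.

Definition is_ehrhart (m : nat) (w : 'I_m -> nat) (lam : quasi_poly) : Prop :=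
  forall r : nat, exists2 N : nat, Tw w r #= `I_N & lam r%:Z = N%:R.

Definition alternating_ehrhart_sum (m : nat) (w : 'I_m -> nat)
    (f : quasi_poly) : Prop :=
  exists2 lam : quasi_poly, is_ehrhart w lam &
  exists s : seq (bool * nat),
    forall t : int, f t = \sum_(x <- s) (-1) ^+ x.1 * lam (t - x.2%:Z).

Definition dimension_quasi_poly (L : fieldType) (m : nat)
    (alpha : 'I_m -> {rmorphism L -> L}) (w : 'I_m -> nat) (K : set L)
    (n : nat) (eta : 'I_n -> L) (f : quasi_poly) : Prop :=
  exists r0 : nat, forall r : nat, (r0 <= r)%N ->
    exists2 d : nat, has_trdeg K (filtration alpha w K eta r) d
                   & f r%:Z = d%:R.

(* Main.v *)
Require Import Defs.
From HB Require Import structures.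
From mathcomp Require Import all_boot all_order all_algebra.
From mathcomp Require Import boolp classical_sets cardinality.
From mathcomp Require Import mpoly.
From mathcomp Require polyrcf.
From mathcomp Require Import ring.

Set Implicit Arguments.
Unset Strict Implicit.
Unset Printing Implicit Defensive.

Import Order.TTheory GRing.Theory Num.Theory.

Local Open Scope classical_set_scope.
Local Open Scope ring_scope.

(** Why the theorem holds.

    Order the transforms tau eta_i so that translations preserve the order and
    the weighted order of tau is compared first. Keep tau eta_i when it is
    transcendental over the field that its predecessors generate over K, and
    call it redundant otherwise. By the exchange property of algebraic
    dependence, the kept transforms with ord tau <= r form a transcendence
    basis of L_r over K, for all r at once (greedy_basis). A translation maps
    an algebraic equation of tau eta_i over its predecessors to such an
    equation of the translated element (redundant_translate). So, for each i,
    the exponents of the redundant transforms of eta_i form a monomial ideal,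
    and tr.deg L_r counts the power products of order at most r outside n
    monomial ideals.

    Monomial ideals are finitely generated (dickson). Inclusion and exclusion
    over generators turns the count into a sum of terms +- lambda(r - c), valid
    once r exceeds all the shifts c, where lambda counts the power products of
    order at most r (staircase_signed_sum). Splitting each exponent k_i by
    division by q / w_i, for q the product of the weights, gives lambda as a sum
    of q^m / (w_1 ... w_m) terms of the form C(floor((t - c)/q) + m, m)
    (size_tw_seq, ehrhart_fun_nat). Hence lambda is a quasi-polynomial whose
    coefficient of t^m is the constant 1 / (m! w_1 ... w_m), and the dimension
    quasi-polynomial is an alternating sum of its shifts, of degree at most m.
    In the inclusion-exclusion the signs add up to 1 for an ideal that is zero
    and to 0 for the other ideals. So the coefficient of t^m is
    a / (m! w_1 ... w_m), where a is the number of free generators, those none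
    of whose transforms is redundant.

    The free generators are sigma-independent by construction. If some x were
    not sigma-algebraic over them, its transforms and theirs would give
    (a + 1) lambda(r) independent elements of L_(r + s) for a fixed s, which
    exceeds the dimension by the comparison of coefficients of t^m
    (sigma_algebraic_free_generators). So a is the difference transcendence
    degree.

    Finally, the filtrations of two systems of generators are cofinal in each
    other with a bounded shift (filtration_shift). Their dimension
    quasi-polynomials thus satisfy f(r) <= g(r') and g(r) <= f(r') whenever r is
    large and r' >= r + s. As r' ranges over all residue classes, every
    constituent of f can be compared with every constituent of g, which forces
    equal degrees and the same constant leading coefficient (qp_coef_leq). *)

(** * Algebraic elements over a subfield *)

Section SubfieldType.
Variables (L : fieldType) (F : set L).

(** Indexed by the proof, so that the closure properties can be attached to the
    predicate and inferred from it. *)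
Definition carrier of subfield F : pred L := fun x => x \in mem F.

Variable sF : subfield F.

Let carrier_divring_closed : GRing.divring_closed (carrier sF).
Proof. exact: sF. Qed.

HB.instance Definition _ :=
  GRing.isDivringClosed.Build L (carrier sF) carrier_divring_closed.

Record subfield_type :=
  SubfieldElt { subfield_val : L; _ : subfield_val \in carrier sF }.

HB.instance Definition _ := [isSub for subfield_val].
HB.instance Definition _ := [Choice of subfield_type by <:].
HB.instance Definition _ :=
  [SubChoice_isSubIntegralDomain of subfield_type by <:].
HB.instance Definition _ :=
  [SubIntegralDomain_isSubField of subfield_type by <:].

Let incl : {rmorphism subfield_type -> L} := \val.

Lemma carrierE x : (x \in carrier sF) = (x \in F).
Proof. by []. Qed.

Lemma subfield_polyOverP (p : {poly L}) :
  reflect (forall i, F p`_i) (p \is a polyOver (mem F)).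
Proof.
have -> : (p \is a polyOver (mem F)) = (p \is a polyOver (carrier sF)) by [].
apply: (iffP polyOverP) => H i; first by have := H i; rewrite carrierE inE.
by rewrite carrierE inE.
Qed.

(** Over a field algebraic and integral elements agree; the theory of integral
    elements supplies the closure properties below. *)
Lemma algebraic_overP x : algebraic_over F x <-> integralOver incl x.
Proof.
split=> [[p [Fp p0 px]]|].
  apply/integral_algebraic.
  have mapK (q : {poly L}) : q \is a polyOver (mem F) ->
      exists q' : {poly subfield_type}, map_poly incl q' = q.
    move=> /subfield_polyOverP Fq.
    exists (\poly_(i < size q) insubd (0 : subfield_type) q`_i).
    apply/polyP => i; rewrite coef_map coef_poly; case: ltnP => [_|qi].
      by rewrite /= insubdK // unfold_in mem_set.
    by rewrite nth_default //; exact: (rmorph0 incl).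
  have [p' Ep'] := mapK p Fp.
  exists p'; last by rewrite Ep'.
  by apply: contraNneq p0 => p'0; rewrite -Ep' p'0 rmorph0.
move=> /integral_algebraic [p p0 px]; exists (map_poly incl p).
split=> //; last by rewrite map_poly_eq0.
apply/subfield_polyOverP => i; rewrite coef_map /=; apply/set_mem.
exact: (valP p`_i).
Qed.

Lemma algebraic_over_root (p : {poly L}) x :
  p != 0 -> root p x -> (forall i, algebraic_over F p`_i) -> algebraic_over F x.
Proof.
move=> p0 px algp; apply/algebraic_overP; apply: integral_root p0 px _.
by apply/(integral_poly incl) => i; apply/algebraic_overP.
Qed.

Lemma subfield_algebraic_over : subfield (algebraic_over F).
Proof.
split=> [|x y|x y]; rewrite !inE !algebraic_overP.
- exact: integral1.
- exact: integral_sub.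
- exact: integral_div.
Qed.

Lemma sub_algebraic_over : F `<=` algebraic_over F.
Proof.
move=> x Fx; apply/algebraic_overP.
have Sx : x \in carrier sF by rewrite carrierE inE.
exact: (integral_id incl (SubfieldElt Sx)).
Qed.

End SubfieldType.

Lemma subfieldP (L : fieldType) (F : set L) :
  subfield F <-> [/\ F 1, forall x y, F x -> F y -> F (x - y)
                   & forall x y, F x -> F y -> F (x / y)].
Proof.
split=> [[F1 FB FV]|[F1 FB FV]]; split.
- by move: F1; rewrite inE.
- by move=> x y; rewrite -!(in_setE F); apply: FB.
- by move=> x y; rewrite -!(in_setE F); apply: FV.
- by rewrite inE.
- by move=> x y; rewrite !inE; apply: FB.
- by move=> x y; rewrite !inE; apply: FV.
Qed.

(** * Field generation and the exchange property *)

Section Adjoin.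
Variable L : fieldType.
Implicit Types (K F S T R : set L) (x y : L).

Lemma subfield_adjoin K S : subfield (adjoin K S).
Proof.
apply/subfieldP; split=> [|x y Kx Ky|x y Kx Ky] F [sF SF];
  have [F1 FB FV] := (subfieldP F).1 sF => //.
- by apply: FB; [apply: Kx|apply: Ky].
- by apply: FV; [apply: Kx|apply: Ky].
Qed.

Lemma sub_adjoinl K S : K `<=` adjoin K S.
Proof. by move=> x Kx F [_ SF]; apply: SF; left. Qed.

Lemma sub_adjoinr K S : S `<=` adjoin K S.
Proof. by move=> x Sx F [_ SF]; apply: SF; right. Qed.

Lemma adjoin_min K S F :
  subfield F -> K `<=` F -> S `<=` F -> adjoin K S `<=` F.
Proof. by move=> sF KF SF; apply: smallest_sub => // x [/KF|/SF]. Qed.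

Lemma adjoin_sub K K' S S' :
  K `<=` K' -> S `<=` S' -> adjoin K S `<=` adjoin K' S'.
Proof.
move=> KK' SS'; apply: adjoin_min; first exact: subfield_adjoin.
- exact: subset_trans KK' (@sub_adjoinl _ _).
- exact: subset_trans SS' (@sub_adjoinr _ _).
Qed.

Lemma algebraic_over_sub F F' :
  subfield F -> subfield F' -> F `<=` F' ->
  algebraic_over F `<=` algebraic_over F'.
Proof.
move=> sF sF' FF' x [p [/(subfield_polyOverP sF) Fp p0 px]]; exists p.
by split=> //; apply/subfield_polyOverP => // i; apply/FF'.
Qed.

(** The algebraic closure in L of the field that S generates over K; these
    operators form the matroid whose bases are the transcendence bases. *)
Definition acl K S : set L := algebraic_over (adjoin K S).

Lemma subfield_acl K S : subfield (acl K S).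
Proof. exact: subfield_algebraic_over (subfield_adjoin K S). Qed.

Lemma adjoin_acl K S : adjoin K S `<=` acl K S.
Proof. exact: sub_algebraic_over (subfield_adjoin K S). Qed.

Lemma acl_sub K K' S S' : K `<=` K' -> S `<=` S' -> acl K S `<=` acl K' S'.
Proof.
move=> KK' SS'; apply: algebraic_over_sub (adjoin_sub KK' SS');
exact: subfield_adjoin.
Qed.

Lemma mem_acl K S : S `<=` acl K S.
Proof. exact: subset_trans (@sub_adjoinr K S) (@adjoin_acl K S). Qed.

(** Transitivity of algebraicity: the elements algebraic over K(S) form a
    field, which therefore contains the coefficients of any equation with
    coefficients in K(T). *)
Lemma acl_trans K S T : T `<=` acl K S -> acl K T `<=` acl K S.
Proof.
move=> TS x [p [/(subfield_polyOverP (subfield_adjoin _ _)) Tp p0 px]].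
apply: algebraic_over_root p0 px _ => [|i]; first exact: subfield_adjoin.
have: adjoin K T `<=` acl K S; last by apply.
apply: adjoin_min => //; first exact: subfield_acl.
exact: subset_trans (@sub_adjoinl K S) (@adjoin_acl K S).
Qed.

Definition fractions R : set L :=
  [set z | exists a b, [/\ R a, R b, b != 0 & z = a / b]].

Lemma subfield_fractions R :
  R 1 -> (forall a b, R a -> R b -> R (a - b)) ->
  (forall a b, R a -> R b -> R (a * b)) -> subfield (fractions R).
Proof.
move=> R1 RB RM; have R0 : R 0 by rewrite -(subrr 1); apply: RB.
apply/subfieldP; split=> [|_ _ [a [b [Ra Rb b0 ->]]] [c [d [Rc Rd d0 ->]]]|
    _ _ [a [b [Ra Rb b0 ->]]] [c [d [Rc Rd d0 ->]]]].
- by exists 1, 1; rewrite divr1 oner_neq0.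
- exists (a * d - c * b), (b * d); rewrite mulf_neq0 //.
  split=> //; [by apply: RB; apply: RM|exact: RM|].
  by rewrite -mulNr addf_div // mulNr.
- have [->|c0] := eqVneq c 0.
    by exists 0, 1; rewrite mul0r invr0 mulr0 divr1 oner_neq0.
  exists (a * d), (b * c); rewrite mulf_neq0 //.
  split=> //; [exact: RM|exact: RM|].
  by rewrite invf_div mulf_div.
Qed.

Lemma sub_fractions R : R 1 -> R `<=` fractions R.
Proof. by move=> R1 x Rx; exists x, 1; rewrite divr1 oner_neq0. Qed.

Lemma common_denominator R (p : {poly L}) :
  R 1 -> (forall a b, R a -> R b -> R (a * b)) ->
  (forall i, fractions R p`_i) ->
  exists2 b, R b /\ b != 0 & forall i, (i < size p)%N -> R (b * p`_i).
Proof.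
move=> R1 RM Rp; elim: (size p) => [|k [b [Rb b0] IH]].
  by exists 1; rewrite ?oner_neq0.
have [a [c [Ra Rc c0 Epk]]] := Rp k; exists (b * c).
  by split; [exact: RM|exact: mulf_neq0].
move=> i; rewrite ltnS leq_eqVlt => /orP[/eqP->|lt_ik].
  by rewrite Epk -mulrA (mulrC c) divfK //; apply: RM.
by rewrite mulrAC; apply: RM => //; apply: IH.
Qed.

(** Steinitz exchange. An equation of x over K(S)(y) becomes, after clearing
    denominators, a polynomial relation P(y, x) = 0 over K(S). Read as an
    equation for y over K(S)(x) it is nontrivial: if all its coefficients,
    which are polynomials in x over K(S), vanished, then x would be algebraic
    over K(S). *)
Lemma acl_exchange K S x y :
  acl K (y |` S) x -> ~ acl K S x -> acl K (x |` S) y.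
Proof.
set E := adjoin K S; have sE : subfield E by exact: subfield_adjoin.
have [E1 EB EV] := (subfieldP E).1 sE.
have E0 : E 0 by rewrite -(subrr 1); apply: EB.
pose R := [set z | exists2 g : {poly L}, g \is a polyOver (mem E) & z = g.[y]].
have RC a : E a -> R a.
  move=> Ea; exists a%:P; rewrite ?hornerC //.
  apply/(subfield_polyOverP sE) => i; rewrite coefC.
  by case: eqP.
have R1 : R 1 by exact: RC.
have RB a b : R a -> R b -> R (a - b).
  move=> [g Eg ->] [h Eh ->]; exists (g - h); rewrite ?hornerE //.
  rewrite -[_ \is a _]/(_ \is a polyOver (carrier sE)).
  by apply: rpredB.
have RM a b : R a -> R b -> R (a * b).
  move=> [g Eg ->] [h Eh ->]; exists (g * h); rewrite ?hornerE //.
  rewrite -[_ \is a _]/(_ \is a polyOver (carrier sE)).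
  by apply: rpredM.
have Ry : R y.
  exists 'X; rewrite ?hornerX //.
  apply/(subfield_polyOverP sE) => i; rewrite coefX.
  by case: (i == 1%N).
have sub_frac : adjoin K (y |` S) `<=` fractions R.
  have ER : E `<=` fractions R.
    by move=> a Ea; apply: sub_fractions => //; apply: RC.
  apply: adjoin_min; first exact: subfield_fractions.
    by move=> a Ka; apply: ER; apply: sub_adjoinl.
  move=> a [->|Sa]; first exact: sub_fractions.
  by apply: ER; apply: sub_adjoinr.
move=> [p [/(subfield_polyOverP (subfield_adjoin _ _)) Fp p0 px]] nEx.
have [i|b [Rb b0] Rp] := common_denominator (p := p) R1 RM.
  by apply: sub_frac; apply: Fp.
have /choice [g Hg] i : exists g : {poly L}, (i < size p)%N ->
    g \is a polyOver (mem E) /\ b * p`_i = g.[y].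
  case: ltnP => [/Rp[g Eg gy]|_]; last by exists 0.
  by exists g.
pose Q := \sum_(i < size p) x ^+ i *: g i.
have Qy : root Q y.
  rewrite rootE horner_sum; apply/eqP.
  transitivity (b * p.[x]); last by rewrite (rootP px) mulr0.
  rewrite horner_coef mulr_sumr; apply: eq_bigr => i _.
  by rewrite hornerZ -(Hg i (ltn_ord i)).2 mulrC mulrA.
pose F := adjoin K (x |` S); have sF : subfield F by exact: subfield_adjoin.
have [Q0|Q0] := eqVneq Q 0; last first.
  exists Q; split=> //.
  have -> : (Q \is a polyOver (mem F)) = (Q \is a polyOver (carrier sF)) by [].
  apply: rpred_sum => i _; apply: polyOverZ.
    by apply: rpredX; rewrite carrierE inE; apply: sub_adjoinr; left.
  apply/(subfield_polyOverP sF) => j.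
  have: E ((g i)`_j) by have [/(subfield_polyOverP sE)] := Hg i (ltn_ord i).
  by apply: adjoin_sub => // z Sz; right.
(* Here every coefficient of Q, a polynomial in x over K(S), vanishes. *)
exfalso; apply: nEx.
have [i0 gi0] : exists i : 'I_(size p), g i != 0.
  have ltp : ((size p).-1 < size p)%N by rewrite prednK ?size_poly_gt0.
  exists (Ordinal ltp); apply/eqP => /= g0.
  have [_] := Hg _ ltp; rewrite g0 horner0 => /eqP.
  by rewrite mulf_eq0 (negPf b0) -/(lead_coef p) lead_coef_eq0 (negPf p0).
pose j := (size (g i0)).-1.
exists (\poly_(i < size p) (g i)`_j); split.
- apply/(subfield_polyOverP sE) => i; rewrite coef_poly; case: ltnP => [lti|_].
    by have [/(subfield_polyOverP sE)] := Hg _ lti.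
  exact: E0.
- apply: contraNneq gi0 => /(congr1 (fun q : {poly L} => q`_i0)).
  rewrite coef_poly ltn_ord coef0 -/(lead_coef _) => /eqP.
  by rewrite lead_coef_eq0.
- rewrite rootE horner_poly; apply/eqP.
  transitivity Q`_j; last by rewrite Q0 coef0.
  by rewrite coef_sum; apply: eq_bigr => i _; rewrite coefZ mulrC.
Qed.

End Adjoin.

(** * Polynomial relations and successive transcendence *)

Section LastVariable.
Variables (n : nat) (R : comNzRingType).
Local Notation widen := (widen_ord (leqnSn n)).
Implicit Types (p : {mpoly R[n.+1]}) (q : {mpoly R[n]}).

Lemma ord_lastP (i : 'I_n.+1) : i = ord_max \/ exists j, i = widen j.
Proof.
have [lt_in|le_ni] := ltnP i n.
  by right; exists (Ordinal lt_in); apply: val_inj.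
by left; apply: val_inj; apply/eqP; rewrite eqn_leq le_ni -ltnS ltn_ord.
Qed.

Lemma mnm_lastE (m : 'X_{1..n}) j :
  (mnmwiden m + U_(ord_max) *+ j)%MM ord_max = j.
Proof. by rewrite mnmDE mulmnE mnm1E eqxx mul1n mnmwiden_ordmax. Qed.

Lemma mnm_widenE (m : 'X_{1..n}) j i :
  (mnmwiden m + U_(ord_max) *+ j)%MM (widen i) = m i.
Proof.
rewrite mnmDE mulmnE mnm1E mnmwiden_widen -val_eqE /=.
by rewrite gtn_eqF ?ltn_ord // mul0n addn0.
Qed.

Lemma mnm_split (k : 'X_{1..n.+1}) :
  k = (mnmwiden [multinom k (widen i) | i < n] + U_(ord_max) *+ k ord_max)%MM.
Proof.
apply/mnmP => i; have [->|[j ->]] := ord_lastP i; first by rewrite mnm_lastE.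
by rewrite mnm_widenE mnmE.
Qed.

Lemma mcoeff_muni p j (m : 'X_{1..n}) :
  ((muni p)`_j)@_m = p@_(mnmwiden m + U_(ord_max) *+ j)%MM.
Proof.
rewrite muniE coef_sum [in RHS](mpolyE p) !raddf_sum /=.
apply: eq_bigr => k _.
rewrite coefZ coefXn mulr_natr mcoeffMn !mcoeffZ !mcoeffX.
rewrite -mulrnAr -mulrnA mulnb; congr (_ * (nat_of_bool _)%:R).
apply/andP/eqP => [[/eqP <- /eqP ->]|->]; first exact: mnm_split.
rewrite mnm_lastE eqxx; split=> //.
by apply/eqP/mnmP => i; rewrite mnmE mnm_widenE.
Qed.

Lemma muni_eq0 p : muni p = 0 -> p = 0.
Proof.
move=> p0; apply/mpolyP => m.
by rewrite [m]mnm_split -mcoeff_muni p0 coef0 !mcoeff0.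
Qed.

Lemma muni_mwiden q : muni (mwiden q) = q%:P.
Proof.
apply/polyP => j; apply/mpolyP => m; rewrite mcoeff_muni coefC.
case: j => [|j]; first by rewrite mulm0n addm0 mwiden_mnmwiden.
rewrite mcoeff0 (mwidenE (leqnn _)) raddf_sum big1 //= => k _.
rewrite mcoeffZ mcoeffX; case: eqP => [|_]; last by rewrite mulr0.
by move/mnmP/(_ ord_max); rewrite mnm_lastE mnmwiden_ordmax.
Qed.

Lemma muni_lastX : muni ('X_ord_max : {mpoly R[n.+1]}) = 'X.
Proof.
apply/polyP => j; apply/mpolyP => m; rewrite mcoeff_muni mcoeffX coefX.
have -> : (U_(ord_max) == mnmwiden m + U_(ord_max) *+ j)%MM =
    (m == 0%MM) && (j == 1%N).
  apply/eqP/andP => [/mnmP E|[/eqP-> /eqP->]]; last first.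
    by rewrite mnmwiden0 add0m mulm1n.
  split.
    apply/eqP/mnmP => i; have := E (widen i).
    by rewrite mnm_widenE mnm1E mnmE -val_eqE /= gtn_eqF ?ltn_ord.
  by have := E ord_max; rewrite mnm_lastE mnm1E eqxx => <-.
by case: (j == 1%N); rewrite ?andbF ?mcoeff0 // andbT mcoeff1.
Qed.

Lemma meval_muni (v : 'I_n.+1 -> R) p :
  p.@[v] = (map_poly (meval (v \o widen)) (muni p)).[v ord_max].
Proof.
rewrite muniE mevalE raddf_sum horner_sum /=; apply: eq_bigr => m _.
rewrite -mul_polyC rmorphM /= map_polyC map_polyXn hornerM hornerC hornerXn.
rewrite /= mevalZ mevalX big_ord_recr /= mulrA; congr (_ * _ * _).
by apply: eq_bigr => i _; rewrite mnmE.
Qed.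

End LastVariable.

Section AlgFree.
Variable L : fieldType.
Implicit Types (K F S T : set L) (x y : L) (s t : seq L).

(** Algebraic independence in a form suited to induction; that the order of the
    entries does not matter is a consequence of the exchange property. *)
Fixpoint alg_free K s : Prop :=
  if s is x :: s' then ~ acl K [set` s'] x /\ alg_free K s' else True.

Lemma rev_map_enumS k (v : 'I_k.+1 -> L) :
  rev (map v (enum 'I_k.+1)) =
  v ord_max :: rev (map (v \o widen_ord (leqnSn k)) (enum 'I_k)).
Proof. by rewrite enum_ordSr map_rcons rev_rcons -map_comp. Qed.

Lemma set_rev_map_enum k (v : 'I_k -> L) :
  [set` rev (map v (enum 'I_k))] = range v.
Proof.
apply/seteqP; split=> x /=; rewrite mem_rev.
  by move=> /mapP[i _ ->]; exists i.
by move=> [i _ <-]; rewrite map_f // mem_enum.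
Qed.

(** Induction on the number of variables: a relation between k + 1 elements,
    viewed as a polynomial in the last variable, is either an equation for the
    last element over the field generated by the others, or its coefficients
    are relations between the others. *)
Lemma alg_freeP K k (v : 'I_k -> L) : subfield K ->
  alg_free K (rev (map v (enum 'I_k))) <->
  forall p : {mpoly L[k]}, p \is a mpolyOver k (mem K) -> p.@[v] = 0 -> p = 0.
Proof.
move=> sK; have [K1 KB KV] := (subfieldP K).1 sK.
have polyK k' (p : {mpoly L[k']}) :
    (p \is a mpolyOver k' (mem K)) = (p \is a mpolyOver k' (carrier sK)).
  by [].
elim: k v => [|k IH] v.
  have -> : enum 'I_0 = [::] by apply/size0nil; rewrite size_enum_ord.
  split=> // _ p _; rewrite [p]nvar0_mpolyC mevalC => ->.
  by rewrite mpolyC0.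
rewrite rev_map_enumS /= set_rev_map_enum; set v' := v \o _.
set E := adjoin K (range v').
have sE : subfield E by apply: subfield_adjoin.
have KE c : c \in carrier sK -> c \in carrier sE.
  by rewrite !carrierE !inE; apply: sub_adjoinl.
have meval_in (q : {mpoly L[k]}) : q \is a mpolyOver k (mem K) -> E q.@[v'].
  rewrite polyK => Kq; apply/set_mem; rewrite -(carrierE sE).
  apply: rpred_mhorner; first exact: mpolyOverS Kq.
  apply/forallP => i; rewrite carrierE inE; apply: sub_adjoinr.
  by exists i.
split=> [[trv /IH freev] p Kp pv0|freev].
  apply: muni_eq0; apply/polyP => j; rewrite coef0.
  have Kpj i : (muni p)`_i \is a mpolyOver k (mem K).
    rewrite polyK; apply/mpolyOverP => m; rewrite mcoeff_muni.
    by move: Kp; rewrite polyK => /mpolyOverP.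
  apply: freev => //.
  have [q0|q0] := eqVneq (map_poly (meval v') (muni p)) 0.
    by have := congr1 (fun q : {poly L} => q`_j) q0; rewrite coef_map coef0.
  case: trv; exists (map_poly (meval v') (muni p)); split=> //.
    apply/(subfield_polyOverP sE) => i; rewrite coef_map.
    exact: meval_in.
  by rewrite rootE -meval_muni pv0.
split; last first.
  apply/IH => q Kq qv0.
  have := freev (mwiden q); rewrite meval_muni muni_mwiden map_polyC hornerC.
  move=> H; apply: (inj_mwiden (R := L)); rewrite raddf0; apply: H => //.
  rewrite polyK (mwidenE (leqnn _)); apply: rpred_sum => m _.
  apply: mpolyOverZ; last exact: mpolyOverX.
  by move: Kq; rewrite polyK => /mpolyOverP.
move=> [p [/(subfield_polyOverP sE) Ep p0 pv]].
pose R := [set z | exists2 g : {mpoly L[k]},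
  g \is a mpolyOver k (mem K) & z = g.@[v']].
have RC a : K a -> R a.
  move=> Ka; exists a%:MP; last by rewrite mevalC.
  by rewrite polyK mpolyOverC carrierE inE.
have R1 : R 1 by apply: RC.
have RB a b : R a -> R b -> R (a - b).
  move=> [g Kg ->] [h Kh ->]; exists (g - h); last by rewrite raddfB.
  by move: Kg Kh; rewrite !polyK; apply: rpredB.
have RM a b : R a -> R b -> R (a * b).
  move=> [g Kg ->] [h Kh ->]; exists (g * h); last by rewrite rmorphM.
  by move: Kg Kh; rewrite !polyK; apply: rpredM.
have sub_frac : E `<=` fractions R.
  apply: (adjoin_min (subfield_fractions R1 RB RM)) => a.
    by move=> Ka; apply: sub_fractions => //; apply: RC.
  move=> [i _ <-]; apply: sub_fractions => //; exists 'X_i.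
    by rewrite polyK; apply: mpolyOverX.
  by rewrite mevalXU.
have [i|b [_ b0] Rp] := common_denominator (p := p) R1 RM.
  by apply: sub_frac; apply: Ep.
have /choice [g Hg] i : exists g : {mpoly L[k]},
    g \is a mpolyOver k (mem K) /\ ((i < size p)%N -> b * p`_i = g.@[v']).
  case: ltnP => [/Rp[g Kg gy]|_]; first by exists g.
  by exists 0; split=> //; apply: mpolyOver0.
pose Q := \sum_(i < size p) mwiden (g i) * 'X_ord_max ^+ i.
have mQ : muni Q = \poly_(i < size p) g i.
  rewrite raddf_sum poly_def; apply: eq_bigr => i _ /=.
  by rewrite rmorphM rmorphXn /= muni_mwiden muni_lastX mul_polyC.
have Q0 : Q = 0.
  apply: freev.
    rewrite polyK; apply: rpred_sum => i _; apply: rpredM; last first.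
      by apply: rpredX; apply: mpolyOverX.
    rewrite (mwidenE (leqnn _)); apply: rpred_sum => m _.
    apply: mpolyOverZ; last exact: mpolyOverX.
    by have [] := Hg i; rewrite polyK => /mpolyOverP.
  rewrite meval_muni mQ; transitivity (b * p.[v ord_max]); last first.
    by rewrite (rootP pv) mulr0.
  rewrite (horner_coef p) mulr_sumr (horner_coef_wide _ (n := size p));
    last first.
    exact: leq_trans (size_poly _ _) (size_poly _ _).
  apply: eq_bigr => i _; rewrite coef_map coef_poly ltn_ord.
  by rewrite mulrA (Hg i).2.
have ltp : ((size p).-1 < size p)%N by rewrite prednK ?size_poly_gt0.
have g0 : g (size p).-1 = 0.
  have := congr1 (fun q : {poly {mpoly L[k]}} => q`_(size p).-1) mQ.
  by rewrite Q0 muni0 coef0 coef_poly ltp.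
have [_ /(_ ltp)] := Hg (size p).-1; rewrite g0 meval0 => /eqP.
by rewrite mulf_eq0 (negPf b0) -/(lead_coef p) lead_coef_eq0 (negPf p0).
Qed.

(** Lists of indices, rather than of members, keep equal members with distinct
    indices apart. *)
Lemma alg_dependentP K (I : eqType) (D : set I) (u : I -> L) : subfield K ->
  alg_dependent K D u <->
  exists l : seq I, [/\ uniq l, forall i, i \in l -> D i
                      & ~ alg_free K (map u l)].
Proof.
move=> sK; split=> [[k [s [p [inj_s Ds Kp p0 pu]]]]|[l [uniq_l Dl nfree]]].
  exists (rev (map s (enum 'I_k))); split.
  - by rewrite rev_uniq map_inj_uniq ?enum_uniq.
  - by move=> i; rewrite mem_rev => /mapP[j _ ->].
  - rewrite map_rev -map_comp => /(alg_freeP _ sK)/(_ p Kp pu) E.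
    by rewrite E eqxx in p0.
pose t := in_tuple (rev l); pose s := tnth t.
have El : l = rev (map s (enum 'I_(size (rev l)))).
  by rewrite map_tnth_enum /= revK.
apply: contrapT => indep; apply: nfree.
rewrite {1}El map_rev -map_comp; apply/(alg_freeP _ sK) => p Kp pu.
apply: contrapT => /eqP p0; apply: indep; exists (size (rev l)), s, p.
split=> //; last by move=> j; apply: Dl; rewrite -mem_rev mem_tnth.
by apply/tuple_uniqP; rewrite rev_uniq.
Qed.

End AlgFree.

(** * Independence, spanning and transcendence degree *)

Section Matroid.
Variable L : fieldType.
Implicit Types (K F S T : set L) (x y : L) (s t c : seq L).

Lemma set_cons x s : [set` x :: s] = x |` [set` s].
Proof.
apply/seteqP; split=> y /=; rewrite inE.
  by case/orP=> [/eqP->|sy]; [left|right].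
by case=> [->|/= ->]; rewrite ?eqxx ?orbT.
Qed.

Lemma set_perm s t : perm_eq s t -> [set` s] = [set` t].
Proof. by move=> st; apply/seteqP; split=> x /=; rewrite (perm_mem st). Qed.

Lemma alg_free_swap K x y s :
  alg_free K (x :: y :: s) -> alg_free K (y :: x :: s).
Proof.
rewrite /= !set_cons => -[nx [ny fs]]; split; [|split=> //].
  by move=> /acl_exchange /(_ ny).
by apply: contra_not nx; apply: acl_sub => // z; right.
Qed.

Lemma alg_free_perm K s t : perm_eq s t -> alg_free K s -> alg_free K t.
Proof.
elim: s t => [|x s IH] t; first by move=> /perm_size/esym/size0nil ->.
move=> st; have xt : x \in t by rewrite -(perm_mem st) mem_head.
case/splitPr: xt st => t1 t2 st.
have {}st : perm_eq s (t1 ++ t2).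
  by rewrite -(perm_cons x) (permPl st) perm_catC /= perm_cons perm_catC.
move=> [nx /(IH _ st) ft].
have {ft nx} : alg_free K (x :: t1 ++ t2) by split=> //; rewrite -(set_perm st).
elim: t1 {st} => //= y t1 IHt /(@alg_free_swap K x y) [ny fx].
split; last exact: IHt.
suff -> : [set` t1 ++ x :: t2] = [set` x :: t1 ++ t2] by [].
by apply: set_perm; rewrite perm_catC /= perm_cons perm_catC.
Qed.

Lemma alg_free_catr K s t : alg_free K (s ++ t) -> alg_free K t.
Proof. by elim: s => //= x s IH [_ /IH]. Qed.

Lemma alg_free_subset (I : eqType) (u : I -> L) K (s t : seq I) :
  uniq s -> uniq t -> {subset t <= s} ->
  alg_free K (map u s) -> alg_free K (map u t).
Proof.
move=> us ut ts fs.
have st : perm_eq s ([seq x <- s | x \notin t] ++ t).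
  apply: uniq_perm => //.
    rewrite cat_uniq filter_uniq // ut andbT; apply/hasPn => x xt.
    by rewrite mem_filter xt.
  move=> x; rewrite mem_cat mem_filter.
  by have [/ts|//] := boolP (x \in t); rewrite ?orbF.
have := alg_free_perm (perm_map u st) fs.
by rewrite map_cat; apply: alg_free_catr.
Qed.

(** Independence adds up in towers. *)
Lemma alg_free_cat K F s t : K `<=` F -> [set` t] `<=` F ->
  alg_free F s -> alg_free K t -> alg_free K (s ++ t).
Proof.
move=> KF tF fs ft; elim: s fs => //= x s IH [nx /IH fst]; split=> //.
apply: contra_not nx; apply: algebraic_over_sub.
- exact: subfield_adjoin.
- exact: subfield_adjoin.
apply: adjoin_min; first exact: subfield_adjoin.
  exact: subset_trans KF (@sub_adjoinl _ _ _).
move=> y /=; rewrite mem_cat => /orP[sy|ty]; first exact: sub_adjoinr.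
by apply: sub_adjoinl; apply: tF.
Qed.

Lemma alg_free_uniq K s : alg_free K s -> uniq s.
Proof.
elim: s => //= x s IH [nx /IH ->]; rewrite andbT.
by apply: contra_notN nx => xs; apply: mem_acl.
Qed.

(** The exchange argument, in a form fit for induction: c collects the elements
    of s that have already replaced elements of t. *)
Lemma alg_free_leq_span K s t c :
  alg_free K (s ++ c) -> [set` s] `<=` acl K [set` t ++ c] ->
  (size s <= size t)%N.
Proof.
elim: t s c => [|y t IH] s c fs sub.
  case: s fs sub => //= x s [nx _] /(_ x (mem_head _ _)) xc; case: nx.
  by apply: acl_sub xc => // z /= zc; rewrite mem_cat zc orbT.
have [sub'|] := pselect ([set` s] `<=` acl K [set` t ++ c]).
  exact: leq_trans (IH _ _ fs sub') (leqnSn _).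
move=> /existsNP[x /not_implyP[/= xs nx]].
have xcl : acl K (y |` [set` t ++ c]) x by rewrite -set_cons; apply: sub.
have ycl := acl_exchange xcl nx.
have st := perm_to_rem xs.
have szs : (size s = (size (rem x s)).+1)%N by rewrite (perm_size st).
rewrite szs ltnS; apply: (IH _ (x :: c)).
  apply: alg_free_perm fs; rewrite -[x :: c]cat1s perm_sym perm_catCA.
  by rewrite catA perm_cat2r perm_sym.
have Etc : [set` t ++ x :: c] = x |` [set` t ++ c].
  by rewrite -set_cons; apply: set_perm; rewrite -[x :: c]cat1s perm_catCA.
move=> z /= zs; have /sub : z \in s by apply: mem_rem zs.
apply: acl_trans; rewrite set_cons Etc => v [->//|vtc].
by apply: mem_acl; right.
Qed.

Lemma card_eq_uniq (T : choiceType) (s : seq T) :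
  uniq s -> ([set` s] #= `I_(size s))%card.
Proof.
move=> us; have fin_s : finite_set [set` s] by exact: finite_seq.
rewrite -(fset_setK fin_s); apply/card_eq_fsetP/perm_size.
by apply: uniq_perm => // x; rewrite in_fset_set // mem_setE.
Qed.

Lemma card_eq_seq (T : choiceType) (B : set T) d : (B #= `I_d)%card ->
  exists s : seq T, [/\ uniq s, size s = d & B = [set` s]].
Proof.
move=> Bd; have fin_B : finite_set B by apply/finite_setP; exists d.
exists (finmap.enum_fset (fset_set B)).
by rewrite (fset_setK fin_B) (card_fset_set Bd); split.
Qed.

Lemma alg_dependent_seq K s : subfield K -> uniq s ->
  alg_dependent K [set` s] id <-> ~ alg_free K s.
Proof.
move=> sK us; rewrite alg_dependentP //; split=> [[l [ul ls nl]] fs|nfs].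
  by apply: nl; apply: alg_free_subset us ul ls _; rewrite map_id.
by exists s; split=> //; rewrite map_id.
Qed.

Lemma has_trdegP K F d : subfield K ->
  has_trdeg K F d <-> exists s, [/\ size s = d, alg_free K s, [set` s] `<=` F
                                  & F `<=` acl K [set` s]].
Proof.
move=> sK; split=> [[B [BF nB FB] /card_eq_seq[s [us <- EB]]]|].
  exists s; rewrite -EB; split=> //.
  by apply: contrapT => /(alg_dependent_seq sK us); rewrite -EB.
move=> [s [<- fs sF Fs]]; have us := alg_free_uniq fs.
exists [set` s]; last exact: card_eq_uniq.
by split=> // /(alg_dependent_seq sK us).
Qed.

Lemma alg_free_leq_trdeg K F d s : subfield K ->
  has_trdeg K F d -> alg_free K s -> [set` s] `<=` F -> (size s <= d)%N.
Proof.
move=> sK /(has_trdegP _ _ sK)[t [<- _ _ Ft]] fs sF.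
apply: (alg_free_leq_span (K := K) (c := [::])); rewrite ?cats0 //.
exact: subset_trans sF Ft.
Qed.

Lemma has_trdeg_leq K F F' d d' : subfield K -> F `<=` F' ->
  has_trdeg K F d -> has_trdeg K F' d' -> (d <= d')%N.
Proof.
move=> sK FF' /(has_trdegP _ _ sK)[s [<- fs sF _]] hF'.
by apply: alg_free_leq_trdeg hF' fs _ => // x /sF/FF'.
Qed.

End Matroid.

(** * Translations and the greedy basis *)

Section Translate.
Variables (L : fieldType) (m : nat) (alpha : 'I_m -> {rmorphism L -> L}).
Hypothesis alphaC : commuting alpha.
Implicit Types (k l : 'X_{1..m}) (i : 'I_m).

Let word (r : seq 'I_m) k : L -> L :=
  \big[(fun f g : L -> L => f \o g)/id]_(i <- r) iter (k i) (alpha i).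

Let word_cons i r k x : word (i :: r) k x = iter (k i) (alpha i) (word r k x).
Proof. by rewrite /word big_cons. Qed.

Let word_nil k x : word [::] k x = x.
Proof. by rewrite /word big_nil. Qed.

Lemma translate_is_zmod_morphism k : zmod_morphism (translate alpha k).
Proof.
move=> x y; rewrite -[translate alpha k]/(word _ k).
elim: (index_enum _) => [|i r IH]; first by rewrite !word_nil.
by rewrite !word_cons IH; elim: (k i) => //= j ->; rewrite rmorphB.
Qed.

Lemma translate_is_monoid_morphism k : monoid_morphism (translate alpha k).
Proof.
rewrite -[translate alpha k]/(word _ k).
elim: (index_enum _) => [|i r [IH1 IHM]].
  by split=> [|x y]; rewrite !word_nil.
split=> [|x y]; rewrite !word_cons.
  by rewrite IH1; elim: (k i) => //= j ->; rewrite rmorph1.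
by rewrite IHM; elim: (k i) => //= j ->; rewrite rmorphM.
Qed.

HB.instance Definition _ k := GRing.isZmodMorphism.Build L L (translate alpha k)
  (translate_is_zmod_morphism k).
HB.instance Definition _ k := GRing.isMonoidMorphism.Build L L
  (translate alpha k) (translate_is_monoid_morphism k).

Lemma translate0 x : translate alpha 0%MM x = x.
Proof.
rewrite -[translate _ _]/(word _ 0%MM).
elim: (index_enum _) => [|i r IH]; first by rewrite word_nil.
by rewrite word_cons IH mnm0E.
Qed.

Lemma translateD k l x :
  translate alpha (k + l)%MM x = translate alpha k (translate alpha l x).
Proof.
have iterC i j a b y : iter a (alpha i) (iter b (alpha j) y) =
    iter b (alpha j) (iter a (alpha i) y).
  elim: a => //= a ->; elim: b => //= b <-; exact: alphaC.
have wordC i a r y :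
    iter a (alpha i) (word r k y) = word r k (iter a (alpha i) y).
  by elim: r => [|j r IH]; rewrite ?word_nil // !word_cons -IH iterC.
rewrite -![translate _ _]/(word _ _).
elim: (index_enum _) => [|i r IH]; first by rewrite !word_nil.
by rewrite !word_cons IH mnmDE iterD wordC.
Qed.

Lemma translate_mem F k : sigma_subfield alpha F ->
  F `<=` translate alpha k @^-1` F.
Proof.
move=> [_ aF] x Fx; rewrite /preimage /= -[translate _ _]/(word _ k).
elim: (index_enum _) => [|i r IH]; first by rewrite word_nil.
by rewrite word_cons; elim: (k i) => //= j /aF.
Qed.

Lemma translate_alpha i x : translate alpha U_(i)%MM x = alpha i x.
Proof.
have notin r y : i \notin r -> word r U_(i)%MM y = y.
  elim: r => [|j r IH]; first by rewrite word_nil.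
  rewrite inE negb_or => /andP[ij /IH {}IH].
  by rewrite word_cons IH mnm1E (negPf ij).
rewrite -[translate _ _]/(word _ U_(i)%MM).
have := index_enum_uniq 'I_m; have := mem_index_enum i.
elim: (index_enum _) => // j r IH; rewrite inE word_cons mnm1E /=.
case: eqP => [<- _ /andP[ir _]|ij /= ir /andP[_ ur]]; last exact: IH.
by rewrite notin.
Qed.

End Translate.

Section MorphismImages.
Variables (L : fieldType) (f : {rmorphism L -> L}).

Lemma subfield_preimage (F : set L) : subfield F -> subfield (f @^-1` F).
Proof.
move=> /subfieldP[F1 FB FV]; apply/subfieldP.
by split=> [|x y|x y]; rewrite /preimage /= ?rmorph1 ?rmorphB ?fmorph_div //;
  [exact: FB|exact: FV].
Qed.

(** An equation stays nontrivial under f, because f is injective. *)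
Lemma algebraic_over_rmorph (F F' : set L) x : subfield F -> subfield F' ->
  F `<=` f @^-1` F' -> algebraic_over F x -> algebraic_over F' (f x).
Proof.
move=> sF sF' FF' [p [/(subfield_polyOverP sF) Fp p0 px]].
exists (map_poly f p); rewrite map_poly_eq0; split=> //; last first.
  by rewrite /root horner_map (rootP px) rmorph0.
by apply/(subfield_polyOverP sF') => i; rewrite coef_map; apply: FF'.
Qed.

Lemma adjoin_preimage (K F S : set L) : subfield F ->
  K `<=` f @^-1` F -> S `<=` f @^-1` F -> adjoin K S `<=` f @^-1` F.
Proof. by move=> sF; apply: adjoin_min; apply: subfield_preimage. Qed.

End MorphismImages.

Section Greedy.
Variables (L : fieldType) (K : set L).
Variables (I : eqType) (d : Order.disp_t) (O : orderType d) (key : I -> O).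
Variable u : I -> L.
Hypothesis key_inj : injective key.

Definition below i : set I := [set j | (key j < key i)%O].

Definition redundant i : bool := `[< acl K (u @` below i) (u i) >].

(** Along an increasing enumeration of s, a discarded element is algebraic over
    the elements kept before it, and a kept element is transcendental over them.
    Since redundancy does not refer to s, one rule yields a basis of every
    initial segment. *)
Lemma greedy_basis s : uniq s ->
  (forall i j, i \in s -> (key j < key i)%O -> j \in s) ->
  alg_free K (map u [seq i <- s | ~~ redundant i]) /\
  u @` [set` s] `<=` acl K [set` map u [seq i <- s | ~~ redundant i]].
Proof.
pose le := relpre key (fun x y => (y <= x)%O).
have leT : total le by move=> i j; rewrite /le /= orbC le_total.
have le_tr : transitive le by move=> j i k /= ji kj; apply: le_trans kj ji.
wlog sort_s : s / sorted le s => [wl us ds|us].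
  have [//||i j|fs us'] := wl (sort le s).
  - exact: sort_sorted.
  - by rewrite sort_uniq.
  - by rewrite !mem_sort; apply: ds.
  have pss : perm_eq (map u [seq i <- sort le s | ~~ redundant i])
      (map u [seq i <- s | ~~ redundant i]).
    by apply/perm_map/perm_filter; rewrite perm_sort.
  split; first exact: alg_free_perm pss fs.
  rewrite -(set_perm pss) => _ [i si <-]; apply: us'; exists i => //.
  by rewrite /= mem_sort.
elim: s sort_s us => [|i s IH] /=; first by split=> // x [].
rewrite (path_sortedE le_tr) => /andP[/allP le_i sort_s] /andP[ni us] ds.
have s_below j : (j \in s) = (key j < key i)%O.
  apply/idP/idP => [js|ji].
    rewrite lt_neqAle (inj_eq key_inj) [X in _ && X](le_i j js) andbT.
    by apply: contraNneq ni => <-.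
  have := ds i j (mem_head _ _) ji; rewrite inE => /orP[/eqP E|//].
  by rewrite E ltxx in ji.
have [|fs us'] := IH sort_s us.
  move=> j k js kj; rewrite s_below; apply: lt_trans kj _.
  by rewrite -s_below.
have Ebelow : u @` below i = u @` [set` s].
  by congr (u @` _); apply/seteqP; split=> j /=; rewrite s_below.
have [/asboolP dep_i|/asboolPn dep_i] /= := boolP (redundant i).
  split=> // x [j /=]; rewrite inE => /orP[/eqP->|sj] <-; last first.
    by apply: us'; exists j.
  by move: dep_i; rewrite Ebelow; apply: acl_trans.
split.
  split=> //; apply: contra_not dep_i; rewrite Ebelow.
  apply: acl_sub => // x /=.
  move=> /mapP[j]; rewrite mem_filter => /andP[_ js] ->; by exists j.
move=> x [j /=]; rewrite set_cons inE => /orP[/eqP->|sj] <-.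
  by apply: mem_acl; left.
have : acl K [set` map u [seq i <- s | ~~ redundant i]] (u j).
  by apply: us'; exists j.
by apply: acl_sub => // x; right.
Qed.

End Greedy.

(** * The filtration by weighted order *)

Section Orders.
Variables (m : nat) (w : 'I_m -> nat).
Hypothesis w_gt0 : forall i, (0 < w i)%N.
Implicit Types k l : 'X_{1..m}.

Lemma ord_wD k l : ord_w w (k + l)%MM = (ord_w w k + ord_w w l)%N.
Proof. by rewrite -big_split; apply: eq_bigr => i _; rewrite mnmDE mulnDr. Qed.

Lemma mdeg_leq_ord_w k : (mdeg k <= ord_w w k)%N.
Proof. by rewrite mdegE; apply: leq_sum => i _; rewrite leq_pmull. Qed.

Definition tw_seq r : seq 'X_{1..m} :=
  [seq k <- map (@bmnm m r.+1) (enum {: 'X_{1..m < r.+1}})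
     | (ord_w w k <= r)%N].

Lemma mem_tw_seq r k : (k \in tw_seq r) = (ord_w w k <= r)%N.
Proof.
rewrite mem_filter andb_idr // => kr.
have ltk : (mdeg k < r.+1)%N by rewrite ltnS (leq_trans (mdeg_leq_ord_w k)).
by apply/mapP; exists (BMultinom ltk); rewrite ?mem_enum.
Qed.

Lemma uniq_tw_seq r : uniq (tw_seq r).
Proof.
by rewrite filter_uniq // map_inj_uniq ?enum_uniq //; apply: val_inj.
Qed.

Lemma Tw_seq r : Tw w r = [set` tw_seq r].
Proof. by apply/seteqP; split=> k /=; rewrite mem_tw_seq. Qed.

End Orders.

Section Filtration.
Variables (L : fieldType) (m : nat) (alpha : 'I_m -> {rmorphism L -> L}).
Hypothesis alphaC : commuting alpha.
Variables (K : set L) (w : 'I_m -> nat).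
Hypotheses (sfK : sigma_subfield alpha K) (w_gt0 : forall i, (0 < w i)%N).
Variables (n : nat) (eta : 'I_n -> L).
Implicit Types (k l : 'X_{1..m}) (x : 'X_{1..m} * 'I_n).
Local Notation Lr := (filtration alpha w K eta).

Definition transform x : L := translate alpha x.1 (eta x.2).

(** Comparing weighted orders first makes the power products of order at most r
    an initial segment; the other two components only break ties. *)
Definition monomial_key x : (nat *l (nat *l 'X_{1..m}))%type :=
  (ord_w w x.1, (val x.2, x.1)).

Lemma monomial_key_inj : injective monomial_key.
Proof. by move=> [k i] [l j] /= [_ /val_inj -> ->]. Qed.

Lemma monomial_key_ord x y : (monomial_key x < monomial_key y)%O ->
  (ord_w w x.1 <= ord_w w y.1)%N.
Proof. by rewrite ltxi_pair leEnat => /andP[]. Qed.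

Lemma monomial_key_add k x y : (monomial_key x < monomial_key y)%O ->
  (monomial_key ((k + x.1)%MM, x.2) < monomial_key ((k + y.1)%MM, y.2))%O.
Proof. by rewrite !ltxi_pair !leEnat /= !ord_wD !leq_add2l ltmc_add2r. Qed.

Local Notation redundant := (redundant K monomial_key transform).

(** A translation maps an equation of an element over its predecessors to an
    equation of its transform over their transforms, which are predecessors of
    this transform. *)
Lemma redundant_translate k l i : redundant (l, i) -> redundant ((k + l)%MM, i).
Proof.
move=> /asboolP dep; apply/asboolP; rewrite /transform /= translateD //.
apply: (algebraic_over_rmorph (f := translate alpha k)) dep;
  [exact: subfield_adjoin|exact: subfield_adjoin|].
apply: adjoin_preimage; first exact: subfield_adjoin.
  by move=> y Ky; apply: sub_adjoinl; apply: translate_mem.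
move=> _ [[l' j] lt_l'j <-]; apply: sub_adjoinr.
exists ((k + l')%MM, j); first exact: monomial_key_add lt_l'j.
by rewrite /transform /= translateD.
Qed.

Definition monomials r : seq ('X_{1..m} * 'I_n) :=
  [seq (k, i) | k <- tw_seq w r, i <- enum 'I_n].

Lemma mem_monomials r x : (x \in monomials r) = (ord_w w x.1 <= r)%N.
Proof.
case: x => k i; rewrite -mem_tw_seq //; apply/allpairsP/idP => [[] [l j] /=|kr].
  by move=> [? _ [-> _]].
by exists (k, i); rewrite kr mem_enum.
Qed.

Lemma uniq_monomials r : uniq (monomials r).
Proof.
apply: allpairs_uniq; [exact: uniq_tw_seq|exact: enum_uniq|].
by move=> [? ?] [? ?] _ _ [-> ->].
Qed.

Lemma filtrationE r : Lr r = adjoin K (transform @` [set` monomials r]).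
Proof.
congr (adjoin K _); apply/seteqP; split=> y.
  by move=> [i _ [k kr <-]]; exists (k, i); rewrite //= mem_monomials.
move=> [[k i]]; rewrite /= mem_monomials => kr <-.
by exists i => //; exists k.
Qed.

Definition basis_monomials r := [seq x <- monomials r | ~~ redundant x].

Lemma greedy_monomials r :
  alg_free K (map transform (basis_monomials r)) /\
  transform @` [set` monomials r] `<=`
    acl K [set` map transform (basis_monomials r)].
Proof.
apply: (greedy_basis _ _ monomial_key_inj (uniq_monomials r)) => x y.
by rewrite !mem_monomials => xr /monomial_key_ord /leq_trans; apply.
Qed.

Lemma has_trdeg_filtration r :
  has_trdeg K (Lr r) (size (basis_monomials r)).
Proof.
have [free_s span_s] := greedy_monomials r.
apply/has_trdegP; first by case: sfK.
exists (map transform (basis_monomials r)).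
split=> //; first by rewrite size_map.
  rewrite filtrationE => y /= /mapP[x]; rewrite mem_filter => /andP[_ xr] ->.
  by apply: sub_adjoinr; exists x.
rewrite filtrationE; apply: adjoin_min => //; first exact: subfield_acl.
by move=> y Ky; apply: adjoin_acl; apply: sub_adjoinl.
Qed.

Lemma subfield_filtration r : subfield (Lr r).
Proof. exact: subfield_adjoin. Qed.

Lemma filtration_sub r r' : (r <= r')%N -> Lr r `<=` Lr r'.
Proof.
move=> rr'; apply: adjoin_sub => // y [i _ [k kr <-]]; exists i => //.
by exists k => //; apply: leq_trans rr'.
Qed.

Lemma translate_filtration k r :
  Lr r `<=` translate alpha k @^-1` Lr (ord_w w k + r).
Proof.
apply: adjoin_preimage; first exact: subfield_filtration.
  by move=> y Ky; apply: sub_adjoinl; apply: translate_mem.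
move=> _ [i _ [l lr <-]]; apply: sub_adjoinr.
exists i => //; exists (k + l)%MM; last by rewrite translateD.
by rewrite /Tw /= ord_wD leq_add2l.
Qed.

(** A translation moves each level of the filtration into a later one, so the
    union of the levels is a sigma-subfield. *)
Lemma filtration_exhaustive : sigma_generators alpha K eta ->
  forall y, exists r, Lr r y.
Proof.
move=> gen y; have : sigma_adjoin alpha K (range eta) y by rewrite gen.
pose U : set L := [set y | exists r, Lr r y].
suff: sigma_adjoin alpha K (range eta) `<=` U by apply.
have join (x z : L) : U x -> U z -> exists r, Lr r x /\ Lr r z.
  move=> [r xr] [s zs]; exists (maxn r s).
  by split; [apply: filtration_sub xr|apply: filtration_sub zs];
    rewrite (leq_maxl, leq_maxr).
apply: smallest_sub.
  split; last first.
    move=> i x [r xr]; exists (ord_w w U_(i) + r)%N.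
    by rewrite -translate_alpha; apply: translate_filtration.
  apply/subfieldP; split=> [|x z Ux Uz|x z Ux Uz].
  - by exists 0%N; have [? _ _] := (subfieldP (Lr 0)).1 (subfield_filtration 0).
  - have [r [xr zr]] := join x z Ux Uz; exists r.
    by have [_ FB _] := (subfieldP (Lr r)).1 (subfield_filtration r); apply: FB.
  - have [r [xr zr]] := join x z Ux Uz; exists r.
    by have [_ _ FV] := (subfieldP (Lr r)).1 (subfield_filtration r); apply: FV.
move=> x [Kx|[i _ <-]]; first by exists 0%N; apply: sub_adjoinl.
exists 0%N; apply: sub_adjoinr; exists i => //.
exists 0%MM; last exact: translate0.
by rewrite /Tw /= /ord_w big1 // => j _; rewrite mnm0E muln0.
Qed.

End Filtration.

(** Each of the finitely many eta_i already lies in some level of the other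
    filtration; the shift s is the largest of these levels. *)
Lemma filtration_shift (L : fieldType) (m : nat)
    (alpha : 'I_m -> {rmorphism L -> L}) (K : set L) (w : 'I_m -> nat)
    (n n' : nat) (eta : 'I_n -> L) (eta' : 'I_n' -> L) :
  commuting alpha -> sigma_subfield alpha K ->
  sigma_generators alpha K eta' ->
  exists s, forall r,
    filtration alpha w K eta r `<=` filtration alpha w K eta' (r + s).
Proof.
move=> alphaC sfK gen'.
have /choice[s etas] i := filtration_exhaustive alphaC w sfK gen' (eta i).
exists (\max_i s i)%N => r; apply: adjoin_min; first exact: subfield_adjoin.
  by move=> y Ky; apply: sub_adjoinl.
move=> _ [i _ [k kr <-]].
have /= := translate_filtration alphaC sfK (k := k) (etas i).
by apply: filtration_sub; rewrite leq_add //; apply: leq_bigmax.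
Qed.

(** * Counting outside monomial ideals *)

Section Staircase.
Variable m : nat.
Implicit Types (g h k l : 'X_{1..m}) (gs : seq 'X_{1..m}).

(** Dickson's lemma, proved one coordinate at a time. If finitely many elements
    of A suffice when only the coordinates c are compared, and J bounds their
    values at i, then they take care of all k with k i >= J. Each of the
    remaining values of k i cuts out a slice of A to which the induction
    hypothesis applies again. *)
Lemma dickson_coordinates (c : seq 'I_m) (A : set 'X_{1..m}) :
  exists gs, (forall g, g \in gs -> A g) /\
    forall k, A k -> exists2 g, g \in gs & all (fun i => g i <= k i)%N c.
Proof.
elim: c A => [|i c IH] A.
  have [[a Aa]|noA] := pselect (exists a, A a).
    exists [:: a]; split=> [g|k _]; first by rewrite inE => /eqP->.
    by exists a; rewrite ?inE.
  by exists [::]; split=> // k Ak; case: noA; exists k.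
have [gs [Ags dom_gs]] := IH A.
pose J := (\max_(g <- gs) g i)%N.
have /choice [slice slice_dom] j := IH [set k | A k /\ k i = j].
exists (gs ++ flatten [seq slice j | j <- iota 0 J]); split=> [g|k Ak].
  rewrite mem_cat => /orP[/Ags //|/flatten_mapP[j _ gj]].
  by have [/(_ g gj)[]] := slice_dom j.
have [le_Jk|lt_kJ] := leqP J (k i).
  have [g ggs gk] := dom_gs k Ak; exists g; first by rewrite mem_cat ggs.
  by rewrite /= gk andbT (leq_trans _ le_Jk) //; apply: leq_bigmax_seq.
have [mem_slice dom_slice] := slice_dom (k i).
have [g gslice gk] := dom_slice k (conj Ak erefl); exists g.
  rewrite mem_cat; apply/orP; right; apply/flatten_mapP.
  by exists (k i); rewrite ?mem_iota.
by rewrite /= gk andbT (mem_slice g gslice).2.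
Qed.

Definition above gs k : bool := has (fun g => (g <= k)%MM) gs.

Lemma dickson (A : pred 'X_{1..m}) :
  (forall k l, A l -> A (k + l)%MM) -> exists gs, A =1 above gs.
Proof.
move=> upA; have [gs [Ags dom_gs]] := dickson_coordinates (enum 'I_m) A.
exists gs => k; apply/idP/hasP => [/dom_gs[g ggs /allP gk]|[g /Ags Ag gk]].
  by exists g => //; apply/mnm_lepP => i; apply: gk; rewrite mem_enum.
by rewrite -(submK gk); apply: upA.
Qed.

Variable w : 'I_m -> nat.
Hypothesis w_gt0 : forall i, (0 < w i)%N.

Lemma count_shift g (P : pred 'X_{1..m}) r : (ord_w w g <= r)%N ->
  count (fun k => (g <= k)%MM && P (k - g)%MM) (tw_seq w r) =
  count P (tw_seq w (r - ord_w w g)).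
Proof.
move=> gr; rewrite -!size_filter -[RHS](size_map (fun k => k + g)%MM).
apply: perm_size; apply: uniq_perm.
- exact/filter_uniq/uniq_tw_seq.
- rewrite map_inj_uniq; first exact/filter_uniq/uniq_tw_seq.
  by move=> k l /(congr1 (fun h => (h - g)%MM)); rewrite !addmK.
move=> k; rewrite mem_filter mem_tw_seq //.
apply/andP/mapP => [[/andP[gk Pk] kr]|[l]].
  exists (k - g)%MM; last by rewrite submK.
  rewrite mem_filter Pk mem_tw_seq // -(leq_add2r (ord_w w g)) -ord_wD.
  by rewrite submK // subnK.
rewrite mem_filter mem_tw_seq // => /andP[Pl lr] ->.
rewrite lem_addl addmK Pl ord_wD; split=> //.
by rewrite -(subnK gr) leq_add2r.
Qed.

(** The Hilbert function, for the weighted order, of the monomial ideal that gs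
    generates. *)
Definition staircase gs r := count (fun k => ~~ above gs k) (tw_seq w r).

Lemma staircase_cons g gs r : (ord_w w g <= r)%N ->
  staircase gs r = (staircase (g :: gs) r +
    staircase [seq (h - g)%MM | h <- gs] (r - ord_w w g))%N.
Proof.
move=> gr; rewrite /staircase -(count_shift _ gr).
elim: (tw_seq w r) => //= k t ->; rewrite addnACA; congr (_ + _)%N.
have [gk|_] //= := boolP (g <= k)%MM; last by rewrite addn0.
rewrite add0n /above has_map; congr (nat_of_bool (~~ _)); apply: eq_has => h /=.
apply/mnm_lepP/mnm_lepP => hk i; have /mnm_lepP/(_ i) gki := gk; have := hk i;
  by rewrite !mnmE leq_subLR subnKC.
Qed.

(** An alternating sum of shifts of a counting function; the truncation of the
    subtraction is harmless once r is at least every shift. *)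
Definition signed_sum (F : nat -> rat) (s : seq (bool * nat)) r : rat :=
  \sum_(x <- s) (-1) ^+ x.1 * F (r - x.2)%N.

Let signed gs := exists (s : seq (bool * nat)) r0,
  [/\ forall r, (r0 <= r)%N ->
         (staircase gs r)%:R = signed_sum (fun r => (size (tw_seq w r))%:R) s r
    , forall x, x \in s -> (x.2 <= r0)%N
    & \sum_(x <- s) (-1) ^+ x.1 = (nilp gs)%:R :> rat].

Let signed_nil : signed [::].
Proof.
exists [:: (false, 0%N)], 0%N; split=> [r _|x|].
- rewrite /signed_sum big_seq1 /= expr0 mul1r subn0 /staircase.
  by rewrite (eq_count (a2 := predT)) ?count_predT.
- by rewrite inE => /eqP->.
- by rewrite big_seq1.
Qed.

(** Inclusion and exclusion: adding a generator g removes from the staircase a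
    translate by g of the staircase of the generators h - g. The signs add up
    to 0 as soon as there is a generator, since they cancel for gs and for the
    truncated differences. *)
Lemma staircase_signed_sum gs : exists (s : seq (bool * nat)) r0,
  [/\ forall r, (r0 <= r)%N ->
         (staircase gs r)%:R = signed_sum (fun r => (size (tw_seq w r))%:R) s r
    , forall x, x \in s -> (x.2 <= r0)%N
    & \sum_(x <- s) (-1) ^+ x.1 = (nilp gs)%:R :> rat].
Proof.
move: {2}(size gs) (leqnn (size gs)) => N; elim: N gs => [|N IH] [|g gs] //.
rewrite ltnS => gsN; have [s [r0 [Es s0 Ss]]] := IH gs gsN.
pose gs' := [seq (h - g)%MM | h <- gs].
have [|s' [r1 [Es' s1 Ss']]] := IH gs'; first by rewrite size_map.
pose o := ord_w w g.
exists (s ++ [seq (~~ x.1, x.2 + o)%N | x <- s']), (maxn r0 (r1 + o)).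
split=> [r|x|].
- rewrite geq_max => /andP[r0r r1r].
  have or : (o <= r)%N by rewrite (leq_trans _ r1r) ?leq_addl.
  have r1r' : (r1 <= r - o)%N by rewrite leq_subRL // addnC.
  move/(congr1 (fun N => N%:R : rat)): (staircase_cons gs or).
  rewrite natrD Es // Es' // => /eqP; rewrite -subr_eq => /eqP <-.
  rewrite /signed_sum big_cat big_map /= -sumrN; congr (_ + _).
  apply: eq_bigr => x _; rewrite subnDA subnAC -mulNr; congr (_ * _).
  by case: x.1; rewrite ?expr0 ?expr1 ?opprK.
- rewrite mem_cat => /orP[/s0 xs|/mapP[y /s1 ys ->]].
    by rewrite (leq_trans xs) ?leq_maxl.
  by rewrite (leq_trans _ (leq_maxr _ _)) // leq_add2r.
- rewrite big_cat big_map /= Ss.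
  have -> : \sum_(x <- s') (-1) ^+ (~~ x.1) = - (nilp gs')%:R :> rat.
    rewrite -Ss' -sumrN; apply: eq_bigr => x _.
    by case: x.1; rewrite ?expr0 ?expr1 ?opprK.
  by rewrite /nilp size_map subrr.
Qed.

End Staircase.

(** * Counting by quotients and remainders *)

Lemma simplex_size m N :
  size [seq bmnm k | k <- enum {: 'X_{1..m < N.+1}}] = 'C(N + m, m).
Proof.
rewrite addnC -card_partial_ord_partitions cardE -[RHS](size_map
  (fun t : m.-tuple 'I_N.+1 => [multinom val (tnth t i) | i < m])).
apply: perm_size; apply: uniq_perm.
- by rewrite map_inj_uniq ?enum_uniq //; apply: val_inj.
- rewrite map_inj_uniq ?enum_uniq // => s t /mnmP E; apply: eq_from_tnth => i.
  by apply: val_inj; have := E i; rewrite !mnmE.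
move=> k; apply/mapP/mapP => [[[l lN] _ ->]|[t]] /=.
  have lt_lN i : (l i < N.+1)%N.
    by apply: leq_ltn_trans lN; rewrite mdegE (bigD1 i) //= leq_addr.
  pose t := [tuple Ordinal (lt_lN i) | i < m].
  exists t; last by apply/mnmP => i; rewrite mnmE tnth_mktuple.
  rewrite mem_enum inE big_tuple; rewrite mdegE in lN.
  by under eq_bigr do rewrite tnth_mktuple.
rewrite mem_enum inE big_tuple => tN ->.
have lN : (mdeg [multinom val (tnth t i) | i < m] < N.+1)%N.
  by rewrite mdegE ltnS; under eq_bigr do rewrite mnmE.
by exists (BMultinom lN); rewrite ?mem_enum.
Qed.

Section Ehrhart.
Variables (m : nat) (w : 'I_m -> nat).
Hypothesis w_gt0 : forall i, (0 < w i)%N.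
Implicit Types (k a b : 'X_{1..m}).

(** The product is a convenient common multiple of the weights. *)
Definition period := (\prod_(i < m) w i)%N.

Lemma period_gt0 : (0 < period)%N.
Proof. by apply: prodn_gt0. Qed.

Definition cofactor i := (period %/ w i)%N.

Lemma cofactorK i : (w i * cofactor i)%N = period.
Proof. by rewrite mulnC divnK // /period (bigD1 i) //= dvdn_mulr. Qed.

Lemma cofactor_gt0 i : (0 < cofactor i)%N.
Proof. by have := period_gt0; rewrite -(cofactorK i) muln_gt0 => /andP[]. Qed.

Lemma cofactor_leq i : (cofactor i <= period)%N.
Proof. by rewrite -(cofactorK i) leq_pmull. Qed.

(** Every exponent vector k is uniquely of the form
    k_i = b_i + (period / w_i) a_i with b in the box, and its order is then
    ord b + period * |a|. *)
Definition box : seq 'X_{1..m} :=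
  [seq [multinom val (f i) | i < m] |
    f : {ffun 'I_m -> 'I_period}
      in family (fun i => [pred j : 'I_period | (j < cofactor i)%N])].

Lemma mem_box b : (b \in box) = [forall i, (b i < cofactor i)%N].
Proof.
apply/fintype.imageP/forallP => [[f /familyP fF ->] i|lt_b].
  by rewrite mnmE; have := fF i; rewrite inE.
have lt_bq i : (b i < period)%N := leq_trans (lt_b i) (cofactor_leq i).
exists [ffun i => Ordinal (lt_bq i)].
  by apply/familyP => i; rewrite ffunE inE; apply: lt_b.
by apply/mnmP => i; rewrite mnmE ffunE.
Qed.

Lemma uniq_box : uniq box.
Proof.
rewrite map_inj_uniq ?enum_uniq // => f g /mnmP E; apply/ffunP => i.
by apply: val_inj; have := E i; rewrite !mnmE.
Qed.

Lemma size_box : size box = (\prod_(i < m) cofactor i)%N.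
Proof.
rewrite size_map -cardE card_family foldrE big_map big_enum.
apply: eq_bigr => i _; rewrite -sum1_card /=.
rewrite (eq_bigl (fun j : 'I_period => j < cofactor i)%N) //.
by rewrite (big_ord_narrow (cofactor_leq i)) sum1_card card_ord.
Qed.

Definition residue k := [multinom k i %% cofactor i | i < m].

Lemma residue_box k : residue k \in box.
Proof.
by rewrite mem_box; apply/forallP => i; rewrite mnmE ltn_pmod ?cofactor_gt0.
Qed.

Lemma count_residue b r : b \in box ->
  count (fun k => residue k == b) (tw_seq w r) =
  if (ord_w w b <= r)%N then 'C((r - ord_w w b) %/ period + m, m) else 0%N.
Proof.
rewrite mem_box => /forallP lt_b.
pose emb a := [multinom b i + cofactor i * a i | i < m].
have ord_emb a : ord_w w (emb a) = (ord_w w b + period * mdeg a)%N.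
  rewrite mdegE big_distrr -big_split; apply: eq_bigr => i _ /=.
  by rewrite mnmE mulnDr mulnA cofactorK.
have embK k : residue k = b -> k = emb [multinom k i %/ cofactor i | i < m].
  move=> /mnmP kb; apply/mnmP => i; rewrite !mnmE -kb mnmE addnC mulnC.
  exact: divn_eq.
have res_emb a : residue (emb a) = b.
  by apply/mnmP => i; rewrite !mnmE addnC mulnC modnMDl modn_small.
case: leqP => [br|rb]; last first.
  rewrite -(count_pred0 (tw_seq w r)); apply: eq_in_count => k.
  rewrite mem_tw_seq // => kr; apply/eqP => /embK Ek.
  by have := leq_ltn_trans kr rb; rewrite ltnNge Ek ord_emb leq_addr.
rewrite -simplex_size -size_filter -[RHS](size_map emb).
apply: perm_size; apply: uniq_perm.
- exact/filter_uniq/uniq_tw_seq.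
- rewrite map_inj_uniq; last first.
    move=> a a' /mnmP E; apply/mnmP => i; have := E i; rewrite !mnmE => /eqP.
    by rewrite eqn_add2l eqn_pmul2l ?cofactor_gt0 // => /eqP.
  by rewrite map_inj_uniq ?enum_uniq //; apply: val_inj.
move=> k; rewrite mem_filter mem_tw_seq //.
have emb_le a : (ord_w w (emb a) <= r)%N =
    (mdeg a < ((r - ord_w w b) %/ period).+1)%N.
  by rewrite ord_emb -leq_subRL // ltnS leq_divRL ?period_gt0 // mulnC.
apply/andP/mapP => [[/eqP/embK Ek]|[a /mapP[[l ltl] _ ->] ->]].
  rewrite {1}Ek emb_le => lta.
  exists [multinom k i %/ cofactor i | i < m] => //.
  by apply/mapP; exists (BMultinom lta); rewrite ?mem_enum.
by rewrite res_emb eqxx emb_le.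
Qed.

Lemma size_tw_seq r : size (tw_seq w r) =
  (\sum_(b <- box) if (ord_w w b <= r)%N
    then 'C((r - ord_w w b) %/ period + m, m) else 0)%N.
Proof.
have sum_bool (T : Type) (s : seq T) (P : pred T) :
    (\sum_(x <- s) P x = count P s)%N.
  by elim: s => [|x s IH]; rewrite ?big_nil // big_cons IH.
rewrite -sum1_size.
transitivity (\sum_(k <- tw_seq w r) \sum_(b <- box) (residue k == b))%N.
  apply: eq_bigr => k _; rewrite sum_bool.
  rewrite (eq_count (a2 := pred1 (residue k))) => [|b]; last exact: eq_sym.
  by rewrite count_uniq_mem ?uniq_box ?residue_box.
rewrite exchange_big; rewrite !big_seq; apply: eq_bigr => b bb.
by rewrite sum_bool count_residue.
Qed.

Lemma box_ord b : b \in box -> (ord_w w b <= m * period.-1)%N.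
Proof.
rewrite mem_box => /forallP lt_b.
rewrite -[m in (m * _)%N]card_ord -sum_nat_const.
apply: leq_sum => i _; rewrite -ltnS prednK ?period_gt0 // -(cofactorK i).
by rewrite ltn_pmul2l.
Qed.

End Ehrhart.

(** * Ehrhart quasi-polynomials *)

(** Quasi-polynomials of period q as functions, with a bound on the degree and a
    coefficient of t^d that is the same for all constituents. Alternating sums
    of shifts keep this form, and their coefficient of t^d depends only on the
    signs. *)
Definition qp_form (q d : nat) (c : rat) (F : int -> rat) : Prop :=
  exists g : nat -> {poly rat},
    (forall i, (size (g i) <= d.+1)%N /\ (g i)`_d = c) /\
    forall t, F t = (g `|(t %% q%:Z)%Z|%N).[t%:~R].

Lemma coef_comp_shift (R : idomainType) (p : {poly R}) (a : R) d :
  (size p <= d.+1)%N ->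
  (size (p \Po ('X + a%:P)) <= d.+1)%N /\ (p \Po ('X + a%:P))`_d = p`_d.
Proof.
have sizeXa : size ('X + a%:P) = 2 by rewrite -(opprK a) polyCN size_XsubC.
have sz : size (p \Po ('X + a%:P)) = size p by rewrite size_comp_poly2.
rewrite sz => szp; split=> //; move: szp; rewrite leq_eqVlt.
case/orP=> [/eqP szp|szp]; last by rewrite !nth_default ?sz.
have := lead_coef_comp p (q := 'X + a%:P).
have -> : lead_coef ('X + a%:P) = 1 by rewrite -(opprK a) polyCN lead_coefXsubC.
by rewrite sizeXa expr1n mulr1 !lead_coefE sz szp => ->.
Qed.

Section QpForm.
Variables (q d : nat).
Hypothesis q_gt0 : (0 < q)%N.

Let q_neq0 : q%:Z != 0. Proof. by rewrite -lt0n. Qed.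

Lemma qp_form_shift c F a :
  qp_form q d c F -> qp_form q d c (fun t => F (t - a)).
Proof.
move=> [g [gd Fg]]; exists (fun i =>
  g `|((i%:Z - a) %% q%:Z)%Z|%N \Po ('X + (- a%:~R)%:P)); split=> [i|t].
  by have [gs <-] := gd `|((i%:Z - a) %% q%:Z)%Z|%N; apply: coef_comp_shift.
rewrite Fg horner_comp !hornerE rmorphB /=.
by rewrite (gez0_abs (modz_ge0 t q_neq0)) modzDml.
Qed.

Lemma qp_form_sum (I : Type) (r : seq I) (c : rat) (a : I -> rat) F :
  (forall i, qp_form q d c (F i)) ->
  qp_form q d (c * \sum_(i <- r) a i) (fun t => \sum_(i <- r) a i * F i t).
Proof.
move=> /choice[g Hg]; exists (fun j => \sum_(i <- r) a i *: g i j).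
split=> [j|t]; last first.
  rewrite horner_sum; apply: eq_bigr => i _.
  by rewrite hornerZ (Hg i).2.
split.
  elim/big_rec: _ => [|i p _ IH]; first by rewrite size_poly0.
  rewrite (leq_trans (size_polyD _ _)) // geq_max IH andbT.
  apply: leq_trans (size_scale_leq _ _) _.
  by have [/(_ j)[]] := Hg i.
rewrite coef_sum mulr_sumr; apply: eq_bigr => i _.
by rewrite coefZ mulrC; have [/(_ j)[_ ->]] := Hg i.
Qed.

Lemma qp_of_form c F : qp_form q d c F ->
  exists f : quasi_poly, [/\ f =1 F, (qp_size f <= d.+1)%N
                           & forall t, qp_coef f d t = c].
Proof.
move=> [g [gd Fg]].
have sz : (0 < size (mkseq g q))%N by rewrite size_mkseq.
exists (QuasiPoly sz).
have partE t : qp_part (QuasiPoly sz) t = g `|(t %% q%:Z)%Z|%N.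
  rewrite /qp_part /= size_mkseq nth_mkseq //.
  by rewrite -ltz_nat gez0_abs ?modz_ge0 // ltz_pmod.
split=> [t||t].
- by rewrite /qp_eval partE Fg.
- rewrite /qp_size /=; apply/bigmax_leqP_seq => p /mapP[i _ ->] _.
  by have [] := gd i.
- by rewrite /qp_coef partE; have [] := gd `|(t %% q%:Z)%Z|%N.
Qed.

End QpForm.

(** The binomial coefficient 'C(z + m, m) as a polynomial function of z. *)
Definition simplex_fun m (z : int) : rat :=
  (m`!%:R)^-1 * \prod_(j < m) (z + j.+1%:Z)%:~R.

Lemma simplex_fun_nat m N : simplex_fun m N%:Z = 'C(N + m, m)%:R.
Proof.
have m0 : m`!%:R != 0 :> rat by rewrite pnatr_eq0 -lt0n fact_gt0.
apply: (mulfI m0); rewrite mulrA divff // mul1r -natrM mulnC bin_ffact.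
rewrite ffact_prod natr_prod (reindex_inj rev_ord_inj) /=.
apply: eq_bigr => j _; rewrite -PoszD -pmulrn; congr (_%:R).
by rewrite subnSK // addnBA // ltnW.
Qed.

Lemma simplex_fun_eq0 m z : - m%:Z <= z -> z < 0 -> simplex_fun m z = 0.
Proof.
case: z => // N mN _; have lt_Nm : (N < m)%N.
  by move: mN; rewrite NegzE lerN2.
rewrite /simplex_fun (bigD1 (Ordinal lt_Nm)) //= NegzE addNr mul0r.
by rewrite mulr0.
Qed.

Lemma qp_form_simplex m q c : (0 < q)%N ->
  qp_form q m (m`!%:R * q%:R ^+ m)^-1
    (fun t => simplex_fun m ((t - c) %/ q%:Z)%Z).
Proof.
move=> q_gt0; have q0 : q%:R != 0 :> rat by rewrite pnatr_eq0 -lt0n.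
have qz0 : q%:Z != 0 by rewrite -lt0n.
(* On the class of i modulo q, the floor of (t - c) / q is (t - a i) / q. *)
pose a i : int := c + ((i%:Z - c) %% q%:Z)%Z.
pose P i := \prod_(j < m) ('X - ((a i)%:~R - q%:R * j.+1%:R)%:P) : {poly rat}.
exists (fun i => (m`!%:R * q%:R ^+ m)^-1 *: P i); split=> [i|t].
  have szP : size (P i) = m.+1.
    by rewrite size_prod_XsubC /index_enum -enumT size_enum_ord.
  have monP : P i \is monic by apply: monic_prod_XsubC.
  split; first by rewrite -szP size_scale_leq.
  rewrite coefZ -[m in X in _ * X]/(m.+1.-1) -szP -lead_coefE.
  by rewrite (monicP monP) mulr1.
rewrite hornerZ horner_prod /simplex_fun invfM -mulrA; congr (_ * _).
rewrite -exprVn -[in q%:R^-1 ^+ m](card_ord m) -prodr_const -big_split.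
set z := ((t - c) %/ q%:Z)%Z.
have Et : t = a `|(t %% q%:Z)%Z|%N + z * q%:Z.
  rewrite /a (gez0_abs (modz_ge0 t qz0)) modzDml -addrA (addrC (_ %% _)%Z).
  by rewrite -divz_eq addrC subrK.
apply: eq_bigr => j _ /=; rewrite hornerXsubC; apply: (mulfI q0).
rewrite mulrA divff // mul1r; move: (a _) Et => A Et.
have -> : t%:~R = A%:~R + z%:~R * q%:R :> rat by rewrite {1}Et rmorphD rmorphM.
by rewrite rmorphD mulrDr opprB [RHS]addrC addrA subrK addrC (mulrC _ z%:~R).
Qed.

Section EhrhartPolynomial.
Variables (m : nat) (w : 'I_m -> nat).
Hypothesis w_gt0 : forall i, (0 < w i)%N.

Definition ehrhart_fun (t : int) : rat :=
  \sum_(b <- box w) simplex_fun m ((t - (ord_w w b)%:Z) %/ (period w)%:Z)%Z.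

(** Below the order of b the floor lies between - m and - 1, where the binomial
    polynomial vanishes; hence the formula holds for every natural r and not
    only for large ones. *)
Lemma ehrhart_fun_nat r : ehrhart_fun r%:Z = (size (tw_seq w r))%:R.
Proof.
have q_gt0 := period_gt0 w_gt0; have qz_gt0 : (0 < (period w)%:Z) by [].
rewrite size_tw_seq // natr_sum /ehrhart_fun !big_seq; apply: eq_bigr => b bb.
case: leqP => [br|rb]; first by rewrite subzn // divz_nat simplex_fun_nat.
apply: simplex_fun_eq0; last by rewrite ltz_divLR // mul0r subr_lt0.
rewrite lez_divRL // mulNr lerBrDr addrC lerBlDr -PoszM -PoszD lez_nat.
apply: leq_trans (box_ord w_gt0 bb) _.
by rewrite (leq_trans _ (leq_addl _ _)) // leq_mul2l leq_pred orbT.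
Qed.

Lemma qp_form_ehrhart :
  qp_form (period w) m (m`!%:R * \prod_(i < m) (w i)%:R)^-1 ehrhart_fun.
Proof.
have q_gt0 := period_gt0 w_gt0.
have form b := qp_form_simplex m (ord_w w b)%:Z q_gt0.
have := qp_form_sum (box w) (fun=> 1) form.
have -> : (fun t => \sum_(b <- box w) 1 * simplex_fun m
    ((t - (ord_w w b)%:Z) %/ (period w)%:Z)%Z) = ehrhart_fun.
  by apply/funext => t; apply: eq_bigr => b _; rewrite mul1r.
congr (qp_form _ _ _ _); rewrite big_const_seq count_predT iter_addr_0.
have q0 : (period w)%:R != 0 :> rat by rewrite pnatr_eq0 -lt0n.
have : (\prod_(i < m) w i * size (box w) = period w ^ m)%N.
  rewrite size_box // -big_split -[X in (_ ^ X)%N](card_ord m) -prod_nat_const.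
  by apply: eq_bigr => i _; rewrite /= cofactorK.
move/(congr1 (fun N => N%:R : rat)); rewrite natrM natrX natr_prod => <-.
rewrite !invfM -!mulrA; congr (_ * _); rewrite mulVf ?mulr1 //.
rewrite pnatr_eq0 size_box // -lt0n prodn_gt0 // => i.
exact: cofactor_gt0.
Qed.

End EhrhartPolynomial.

(** * Comparing quasi-polynomials *)

Lemma poly_ge0_coef (p : {poly rat}) d : (size p <= d.+1)%N ->
  (forall N, exists2 k : nat, (N <= k)%N & 0 <= p.[k%:R]) -> 0 <= p`_d.
Proof.
move=> szp p_ge0; rewrite leNgt; apply/negP => pd_lt0.
have lead_p : 0 < lead_coef (- p).
  rewrite lead_coefN oppr_gt0 lead_coefE.
  move: szp; rewrite leq_eqVlt => /orP[/eqP->//|szp].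
  by rewrite nth_default // ltxx in pd_lt0.
have [x0 x0P] := polyrcf.poly_pinfty_gt_lc lead_p.
have [k x0k] := p_ge0 (Num.bound `|x0|); rewrite leNgt => /negP; apply.
rewrite -oppr_gt0 -hornerN; apply: lt_le_trans lead_p (x0P _ _).
apply: le_trans (ler_norm _) _; apply: le_trans (ltW (archi_boundP _)) _ => //.
by rewrite ler_nat.
Qed.

Section QuasiPolyTheory.
Implicit Types (f g : quasi_poly) (t : int).

Lemma size_qp_part f t : (size (qp_part f t) <= qp_size f)%N.
Proof.
apply: (leq_bigmax_seq (F := fun g : {poly rat} => size g)) => //.
apply: mem_nth; have := qp_parts_gt0 f; case: (size _) => // q _.
by rewrite -ltz_nat gez0_abs ?modz_ge0 // ltz_pmod.
Qed.

Lemma qp_part_periodic f k t :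
  qp_part f (k * (size (qp_parts f))%:Z + t) = qp_part f t.
Proof. by rewrite /qp_part modzMDl. Qed.

Lemma qp_coef_eq0 f d t : (qp_size f <= d)%N -> qp_coef f d t = 0.
Proof.
by move=> szf; rewrite /qp_coef nth_default // (leq_trans (size_qp_part _ _)).
Qed.

Lemma qp_lead_coef_neq0 f d : qp_size f = d.+1 -> exists t, qp_coef f d t != 0.
Proof.
move=> szf; apply: contrapT => /forallNP lc0.
suff : (qp_size f <= d)%N by rewrite szf ltnn.
apply/bigmax_leqP_seq => p /(nthP 0)[i lti Ep] _.
have Epart : qp_part f i%:Z = p.
  by rewrite /qp_part modz_nat absz_nat modn_small.
have szp : (size p <= d.+1)%N by rewrite -szf -Epart size_qp_part.
move: szp; rewrite leq_eqVlt => /orP[/eqP szp|//]; case: (lc0 i%:Z).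
by rewrite /qp_coef Epart -[d]/(d.+1.-1) -szp -lead_coefE lead_coef_eq0
  -size_poly_eq0 szp.
Qed.

(** The bound on r' is one-sided, so that every class of r modulo the period of
    f can be compared with every class of r' modulo the period of g. *)
Definition eventually_leq f g : Prop := exists s r0, forall r r',
  (r0 <= r)%N -> (r + s <= r')%N -> f r%:Z <= g r'%:Z.

(** Fix c >= s congruent to t' - t modulo the period of g. For the infinitely
    many k congruent to t modulo both periods, f(k) <= g(k + c) says that
    g_t'(X + c) - f_t(X) is nonnegative at k, where f_t and g_t' are the
    constituents; so its coefficient of degree d is nonnegative. The shift by c
    does not affect that coefficient of g_t'. *)
Lemma qp_coef_leq f g d t t' : eventually_leq f g ->
  (qp_size f <= d.+1)%N -> (qp_size g <= d.+1)%N ->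
  qp_coef f d t <= qp_coef g d t'.
Proof.
move=> [s [r0 fg]] szf szg.
have szf_t := leq_trans (size_qp_part f t) szf.
have szg_t' := leq_trans (size_qp_part g t') szg.
set qf := size (qp_parts f); set qg := size (qp_parts g).
have qf_gt0 : (0 < qf)%N := qp_parts_gt0 f.
have qg_gt0 : (0 < qg)%N := qp_parts_gt0 g.
pose Q := (qf * qg)%N; have Q_gt0 : (0 < Q)%N by rewrite muln_gt0 qf_gt0.
pose c := (s + `|((t' - t - s%:Z) %% qg%:Z)%Z|)%N.
have [szc coefc] := coef_comp_shift c%:R szg_t'.
rewrite /qp_coef -subr_ge0 -coefc -coefB; apply: poly_ge0_coef.
  by rewrite (leq_trans (size_polyD _ _)) // size_polyN geq_max szc.
move=> N; pose k := (`|(t %% Q%:Z)%Z| + (N + r0) * Q)%N.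
have Nk : (N + r0 <= k)%N by rewrite (leq_trans (leq_pmulr _ Q_gt0)) ?leq_addl.
exists k; first by rewrite (leq_trans (leq_addr _ _) Nk).
have Ek : k%:Z = ((N + r0)%:Z - (t %/ Q%:Z)%Z) * Q%:Z + t.
  rewrite /k PoszD PoszM gez0_abs ?modz_ge0 -?lt0n //.
  by rewrite /modz; ring.
have Ekc : (k + c)%:Z = ((N + r0)%:Z - (t %/ Q%:Z)%Z) * Q%:Z
    - ((t' - t - s%:Z) %/ qg%:Z)%Z * qg%:Z + t'.
  rewrite PoszD Ek [c%:Z]PoszD gez0_abs ?modz_ge0 -?lt0n //.
  by rewrite /modz; ring.
have := fg k (k + c)%N (leq_trans (leq_addl _ _) Nk).
rewrite leq_add2l leq_addr => /(_ isT).
rewrite -subr_ge0 /qp_eval.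
have -> : qp_part f k%:Z = qp_part f t.
  rewrite Ek /Q PoszM (mulrC qf%:Z) mulrA.
  exact: qp_part_periodic.
have -> : qp_part g (k + c)%:Z = qp_part g t'.
  rewrite Ekc /Q PoszM mulrA -mulrBl.
  exact: qp_part_periodic.
by rewrite hornerD hornerN horner_comp hornerD hornerX hornerC -natrD.
Qed.

Lemma qp_size_leq f g :
  eventually_leq f g -> eventually_leq g f -> (qp_size f <= qp_size g)%N.
Proof.
move=> fg gf; rewrite leqNgt; apply/negP => lt_gf.
have szf : qp_size f = (qp_size f).-1.+1.
  by rewrite prednK // (leq_ltn_trans _ lt_gf).
have szg : (qp_size g <= (qp_size f).-1)%N by rewrite -ltnS -szf.
have [t /eqP[]] := qp_lead_coef_neq0 szf.
have lef : (qp_size f <= (qp_size f).-1.+1)%N by rewrite -szf.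
have leg := leq_trans szg (leqnSn _).
apply/eqP; rewrite eq_le -{1}(qp_coef_eq0 t szg) (qp_coef_leq _ _ fg) //=.
by rewrite -{1}(qp_coef_eq0 t szg) (qp_coef_leq _ _ gf).
Qed.

(** For f = g this says that the leading coefficient of an eventually
    nondecreasing quasi-polynomial is constant. *)
Lemma qp_lead_coef_eq f g t t' : eventually_leq f g -> eventually_leq g f ->
  qp_lead_coef f t = qp_lead_coef g t'.
Proof.
move=> fg gf; have Esz : qp_size f = qp_size g.
  by apply/eqP; rewrite eqn_leq !qp_size_leq.
apply/eqP; rewrite /qp_lead_coef Esz eq_le.
by rewrite (qp_coef_leq _ _ fg) ?(qp_coef_leq _ _ gf) ?Esz ?leqSpred.
Qed.

End QuasiPolyTheory.

(** * The dimension quasi-polynomial *)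

Section SigmaExtension.
Variables (L : fieldType) (m : nat) (alpha : 'I_m -> {rmorphism L -> L}).
Hypothesis alphaC : commuting alpha.
Variables (K : set L) (w : 'I_m -> nat).
Hypotheses (sfK : sigma_subfield alpha K) (w_gt0 : forall i, (0 < w i)%N).

Let ehrhart_lead : rat := (m`!%:R * \prod_(i < m) (w i)%:R)^-1.

Let ehrhart_lead_gt0 : 0 < ehrhart_lead.
Proof.
rewrite invr_gt0 mulr_gt0 ?ltr0n ?fact_gt0 //; apply: prodr_gt0 => i _.
by rewrite ltr0n.
Qed.

Lemma sigma_subfield_adjoin S : sigma_subfield alpha (sigma_adjoin alpha K S).
Proof.
split=> [|i x Kx F HF]; last by have [[_ aF] _] := HF; apply/aF/(Kx F HF).
apply/subfieldP; split=> [|x y Kx Ky|x y Kx Ky] F HF;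
  have [[/subfieldP[F1 FB FV] _] _] := HF => //.
- by apply: FB; [apply: Kx|apply: Ky].
- by apply: FV; [apply: Kx|apply: Ky].
Qed.

Section Generators.
Variables (n : nat) (eta : 'I_n -> L).

Local Notation redundant :=
  (redundant K (@monomial_key m w n) (transform alpha eta)).
Local Notation Lr := (filtration alpha w K eta).

Definition free_generators : seq 'I_n :=
  [seq i <- enum 'I_n | `[< forall k, ~~ redundant (k, i) >]].

Lemma free_generatorsP i k : i \in free_generators -> ~~ redundant (k, i).
Proof. by rewrite /free_generators mem_filter => /andP[/asboolP/(_ k)]. Qed.

Lemma alg_free_generators l : uniq l ->
  (forall x, x \in l -> x.2 \in free_generators) ->
  alg_free K (map (transform alpha eta) l).
Proof.
move=> ul free_l; pose r := (\max_(x <- l) ord_w w x.1)%N.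
have [free_r _] := greedy_monomials alpha K w_gt0 eta r.
apply: alg_free_subset ul _ free_r.
  by rewrite filter_uniq // uniq_monomials.
move=> [k i] xl; rewrite mem_filter free_generatorsP ?(free_l _ xl) //.
rewrite mem_monomials //.
exact: (leq_bigmax_seq (F := fun x => ord_w w x.1)).
Qed.

Lemma size_basis_monomials r :
  size (basis_monomials alpha K w eta r) =
  (\sum_(i < n) count (fun k => ~~ redundant (k, i)) (tw_seq w r))%N.
Proof.
rewrite size_filter /monomials -sum1_count big_mkcond big_allpairs exchange_big.
rewrite big_enum; apply: eq_bigr => i _.
by rewrite -big_mkcond sum1_count.
Qed.

Lemma dimension_quasi_poly_exists : exists Phi : quasi_poly,
  [/\ dimension_quasi_poly alpha w K eta Phi, (qp_size Phi <= m.+1)%N,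
      alternating_ehrhart_sum w Phi
    & forall t, qp_coef Phi m t = ehrhart_lead * (size free_generators)%:R].
Proof.
have /choice[gs gsP] i : exists gs, (fun k => redundant (k, i)) =1 above gs.
  by apply: dickson => k l; apply: redundant_translate.
have /choice[s /choice[r0 sP]] i := staircase_signed_sum w_gt0 (gs i).
pose S := flatten [seq s i | i <- enum 'I_n].
have sumS (f : bool * nat -> rat) :
    \sum_(x <- S) f x = \sum_i \sum_(x <- s i) f x.
  by rewrite big_flatten big_map big_enum.
have q_gt0 := period_gt0 w_gt0.
have eform := qp_form_ehrhart w_gt0.
have [lam [lamE _ _]] := qp_of_form q_gt0 eform.
have := qp_form_sum S (fun x => (-1) ^+ x.1)
  (fun x => qp_form_shift q_gt0 x.2%:Z eform).
move=> /(qp_of_form q_gt0)[Phi [PhiE szPhi coefPhi]]; exists Phi; split=> //.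
- exists (\max_i r0 i)%N => r r0r.
  exists (size (basis_monomials alpha K w eta r)).
    exact: has_trdeg_filtration.
  rewrite size_basis_monomials PhiE sumS natr_sum; apply: eq_bigr => i _.
  have [Es s_r0 _] := sP i.
  have r0ir : (r0 i <= r)%N := leq_trans (leq_bigmax i) r0r.
  rewrite (eq_count (a2 := fun k => ~~ above (gs i) k)); last first.
    by move=> k; rewrite gsP.
  rewrite -/(staircase w (gs i) r) Es // /signed_sum !big_seq.
  apply: eq_bigr => x xs; rewrite subzn ?ehrhart_fun_nat //.
  exact: leq_trans (s_r0 x xs) r0ir.
- exists lam.
    move=> r; exists (size (tw_seq w r)); last by rewrite lamE ehrhart_fun_nat.
    by rewrite Tw_seq //; apply: card_eq_uniq; apply: uniq_tw_seq.
  by exists S => t; rewrite PhiE; apply: eq_bigr => x _; rewrite lamE.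
move=> t; rewrite coefPhi sumS; congr (_ * _).
rewrite size_filter -sum1_count natr_sum big_enum_cond [RHS]big_mkcond.
apply: eq_bigr => i _; have [_ _ ->] := sP i.
case: asboolP => [free_i|nfree]; case gsi : (gs i) => [|g gs'] //=.
  by have := free_i g; rewrite gsP gsi /above /= lepm_refl.
by case: nfree => k; rewrite gsP gsi.
Qed.

Lemma dimension_eventually_leq n' (eta' : 'I_n' -> L) (Phi Phi' : quasi_poly) :
  sigma_generators alpha K eta' ->
  dimension_quasi_poly alpha w K eta Phi ->
  dimension_quasi_poly alpha w K eta' Phi' -> eventually_leq Phi Phi'.
Proof.
move=> gen' [r0 dimPhi] [r0' dimPhi'].
have [s shift] := filtration_shift w eta alphaC sfK gen'.
exists s, (maxn r0 r0') => r r'; rewrite geq_max => /andP[r0r r0'r] rs.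
have [d trd ->] := dimPhi r r0r.
have [d' trd' ->] := dimPhi' r'
  (leq_trans r0'r (leq_trans (leq_addr s r) rs)).
rewrite ler_nat; apply: has_trdeg_leq trd trd'; first by case: sfK.
exact: subset_trans (shift r) (filtration_sub rs).
Qed.

Lemma sigma_free_generators :
  ~ sigma_dependent alpha K [set` map eta free_generators].
Proof.
have sK : subfield K by case: sfK.
move=> /(alg_dependentP _ _ sK)[l [ul l_free nfree]]; apply: nfree.
have [l' El free_l'] : exists2 l' : seq ('X_{1..m} * 'I_n),
    l = [seq (x.1, eta x.2) | x <- l'] &
    forall x, x \in l' -> x.2 \in free_generators.
  elim: l l_free {ul} => [|[k y] l IH] l_free; first by exists [::].
  have [|l' -> free_l'] := IH.
    by move=> x xl; apply: l_free; rewrite inE xl orbT.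
  have [_ /= /mapP[i free_i ->]] := l_free _ (mem_head _ _).
  by exists ((k, i) :: l') => // x; rewrite inE => /orP[/eqP->|/free_l'].
rewrite El -map_comp; apply: (alg_free_generators (l := l')) => //.
by move: ul; rewrite El; apply: map_uniq.
Qed.

Lemma size_set_free_generators :
  ([set` map eta free_generators] #= `I_(size free_generators))%card.
Proof.
rewrite -(size_map eta); apply: card_eq_uniq; apply: (@alg_free_uniq _ K).
have := alg_free_generators (l := [seq (0%MM, i) | i <- free_generators]).
rewrite -map_comp (eq_map (g := eta)) => [|i]; last exact: translate0.
apply; last by move=> _ /mapP[i ? ->].
rewrite map_inj_uniq => [|i j [->] //]; exact/filter_uniq/enum_uniq.
Qed.

Section DimensionBound.
Hypothesis eta_gen : sigma_generators alpha K eta.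
Variable Phi : quasi_poly.
Hypotheses (dimPhi : dimension_quasi_poly alpha w K eta Phi)
  (size_Phi : (qp_size Phi <= m.+1)%N)
  (coef_Phi : forall t,
     qp_coef Phi m t = ehrhart_lead * (size free_generators)%:R).

(** If x were transcendental over the free generators, its transforms together
    with theirs would be independent, and their number would grow faster than
    the dimension quasi-polynomial allows. *)
Lemma sigma_algebraic_free_generators x :
  sigma_algebraic alpha (sigma_adjoin alpha K [set` map eta free_generators]) x.
Proof.
set B := [set` _]; set F := sigma_adjoin alpha K B.
have sF : sigma_subfield alpha F := sigma_subfield_adjoin B.
have sK : subfield K by case: sfK.
have sFF : subfield F by case: sF.
apply: contrapT => trx.
have KF : K `<=` F by move=> y Ky G [_ SG]; apply: SG; left.
have BF : B `<=` F by move=> y By G [_ SG]; apply: SG; right.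
pose a := size free_generators.
have free_x r : alg_free F [seq translate alpha k x | k <- tw_seq w r].
  apply: contrapT => nfree; apply: trx; apply/alg_dependentP => //.
  by exists (tw_seq w r); split=> //; apply: uniq_tw_seq.
pose gens r := [seq (k, i) | k <- tw_seq w r, i <- free_generators].
have gensP r y : y \in gens r ->
    (ord_w w y.1 <= r)%N /\ y.2 \in free_generators.
  by move=> /allpairsP[[k i] /= [kr ? ->]]; rewrite -mem_tw_seq.
have free_gens r : alg_free K (map (transform alpha eta) (gens r)).
  apply: alg_free_generators => [|y /gensP[]//]; apply: allpairs_uniq.
  - exact: uniq_tw_seq.
  - exact/filter_uniq/enum_uniq.
  - by move=> [? ?] [? ?] _ _ [-> ->].
have [s xs] := filtration_exhaustive alphaC w sfK eta_gen x.
have [r0 dimP] := dimPhi.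
have q_gt0 := period_gt0 w_gt0.
have := qp_form_sum [:: tt] (fun=> a.+1%:R) (fun=> qp_form_ehrhart w_gt0).
move=> /(qp_of_form q_gt0)[f [fE size_f coef_f]].
have : eventually_leq f Phi.
  exists s, r0 => r r' r0r rsr'.
  have rr' : (r <= r')%N := leq_trans (leq_addr s r) rsr'.
  have [d trd ->] := dimP r' (leq_trans r0r rr').
  rewrite fE big_seq1 ehrhart_fun_nat // -natrM ler_nat.
  pose T := [seq translate alpha k x | k <- tw_seq w r] ++
    map (transform alpha eta) (gens r).
  have -> : (a.+1 * size (tw_seq w r) = size T)%N.
    by rewrite size_cat !size_map size_allpairs mulnC mulnS.
  apply: alg_free_leq_trdeg trd _ _ => //.
    apply: alg_free_cat KF _ (free_x r) (free_gens r) => y /= /mapP[z].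
    move=> /gensP[_ free_z] ->; have Bz : B (eta z.2) by rewrite /B /= map_f.
    exact: (translate_mem z.1 sF (BF _ Bz)).
  move=> y; rewrite /= mem_cat => /orP[/mapP[k]|/mapP[[k i] /gensP[kr _] ->]].
    rewrite mem_tw_seq // => kr ->.
    have := translate_filtration alphaC sfK (k := k) xs.
    apply: filtration_sub; apply: leq_trans rsr'.
    by rewrite leq_add2r.
  apply: sub_adjoinr; exists i => //; exists k => //.
  exact: leq_trans kr rr'.
move=> /(qp_coef_leq 0 0)/(_ size_f size_Phi).
rewrite coef_f coef_Phi big_seq1 ler_pM2l //.
by rewrite ler_nat ltnn.
Qed.

End DimensionBound.
End Generators.
End SigmaExtension.

Theorem theorem4 (L : fieldType) (charL0 : [pchar L] =i pred0)
    (m : nat) (m_gt0 : (0 < m)%N)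
    (alpha : 'I_m -> {rmorphism L -> L}) (alphaC : commuting alpha)
    (K : set L) (sfK : sigma_subfield alpha K)
    (w : 'I_m -> nat) (w_gt0 : forall i, (0 < w i)%N)
    (n : nat) (eta : 'I_n -> L) (eta_gen : sigma_generators alpha K eta) :
  exists Phi : quasi_poly,
    [/\ (* i *)   dimension_quasi_poly alpha w K eta Phi,
        (* ii *)  (qp_size Phi <= m.+1)%N,
        (* iii *) alternating_ehrhart_sum w Phi
      & (* iv *)
        (exists c : rat, forall (n' : nat) (eta' : 'I_n' -> L)
            (Phi' : quasi_poly),
            sigma_generators alpha K eta' ->
            dimension_quasi_poly alpha w K eta' Phi' ->
            qp_size Phi' = qp_size Phi /\
            (forall t : int, qp_lead_coef Phi' t = c))
        /\ (exists2 a : nat, has_sigma_trdeg alpha K a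
              & forall t : int,
                  qp_coef Phi m t =
                  a%:R / (m`!%:R * \prod_(i < m) (w i)%:R))].
Proof.
have [Phi [dimPhi size_Phi sumPhi coef_Phi]] :=
  dimension_quasi_poly_exists alphaC sfK w_gt0 eta.
exists Phi; split=> //; split.
  exists (qp_lead_coef Phi 0) => n' eta' Phi' gen' dimPhi'.
  have le' := dimension_eventually_leq alphaC sfK gen' dimPhi dimPhi'.
  have ge' := dimension_eventually_leq alphaC sfK eta_gen dimPhi' dimPhi.
  split=> [|t]; last exact: qp_lead_coef_eq.
  by apply/eqP; rewrite eqn_leq !qp_size_leq.
exists (size (free_generators alpha K w eta)); last first.
  by move=> t; rewrite coef_Phi mulrC.
exists [set` map eta (free_generators alpha K w eta)]; last first.
  exact: size_set_free_generators.
split; first exact: sigma_free_generators.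
by move=> x; apply: sigma_algebraic_free_generators dimPhi _ coef_Phi x.
Qed.
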